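(* For each prime $g \geq 5$ and every $\varepsilon>0$, \[ \sum_{0<d<X} h_g(-d) \ll_{\varepsilon,g} X^{\frac{3}{2} - \frac{3}{2g+2} +\varepsilon}\] for all $X\ge 2$, where the sum runs over square-free integers $d$ with $0<d<X$.
   Context: For a square-free positive integer $d$, $h_g(-d)$ denotes the number of ideal classes in the class group of the imaginary quadratic field $\mathbb{Q}(\sqrt{-d})$ whose $g$-th power is the principal class (the ''$g$-part'' of the class number). $A\ll B$ means $|A|\le c|B|$ for a constant $c$ which may depend on $\varepsilon$ (and $g$). *)

(* Defs.v *)
From HB Require Import structures.
From mathcomp Require Import all_boot all_order all_algebra all_field.
From mathcomp Require Import all_classical all_reals all_analysis.

Set Implicit Arguments.
Unset Strict Implicit.
Unset Printing Implicit Defensive.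

Import Order.TTheory GRing.Theory Num.Theory.

Local Open Scope classical_set_scope.
Local Open Scope ring_scope.

Definition squarefree (d : nat) : Prop := forall m : nat, (m ^ 2 %| d)%N -> m = 1%N.

(** The field Q(sqrt(-d)) inside the algebraic numbers. *)
Definition Qsqrt (d : nat) : set algC :=
  [set z | exists a b : rat, z = ratr a + ratr b * sqrtC (- d%:R)].

Definition ring_of_integers (d : nat) : set algC :=
  Qsqrt d `&` [set z | z \in Aint].

(** Nonzero O-submodules of Q(sqrt(-d)) with a common denominator in O. *)
Definition fractional_ideal (d : nat) (I : set algC) : Prop :=
  [/\ I `<=` Qsqrt d,
      (exists2 x, I x & x != 0),
      (forall x y, I x -> I y -> I (x + y)),
      (forall a x, ring_of_integers d a -> I x -> I (a * x)) &
      exists a, [/\ ring_of_integers d a, a != 0 &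
                 forall x, I x -> ring_of_integers d (a * x)]].

Definition ideal_mul (I J : set algC) : set algC :=
  [set z | exists2 s : seq (algC * algC),
     (forall p, p \in s -> I p.1 /\ J p.2) & z = \sum_(p <- s) p.1 * p.2].

(** I and J differ by the principal fractional ideal generated by x. *)
Definition ideal_equiv (d : nat) (I J : set algC) : Prop :=
  exists x, [/\ Qsqrt d x, x != 0 & J = [set x * y | y in I]].

Definition class_of (d : nat) (I : set algC) : set (set algC) :=
  [set J | fractional_ideal d J /\ ideal_equiv d I J].

Definition class_group (d : nat) : set (set (set algC)) :=
  [set class_of d I | I in fractional_ideal d].

Definition principal_class (d : nat) : set (set algC) :=
  class_of d (ring_of_integers d).

Definition class_mul (d : nat) (C D : set (set algC)) : set (set algC) :=
  [set K | exists I J, [/\ C I, D J & class_of d (ideal_mul I J) K]].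

Definition class_exp (d : nat) (C : set (set algC)) (n : nat) : set (set algC) :=
  iter n (class_mul d C) (principal_class d).

(** h_g(-d).  The counting measure is +oo on infinite sets, so an upper bound
    on this quantity includes the finiteness of the set of classes. *)
Definition class_number_part (R : realType) (g d : nat) : \bar R :=
  counting [set C | class_group d C /\ class_exp d C g = principal_class d].

(* Main.v *)
Require Import Defs.
From HB Require Import structures.
From mathcomp Require Import all_boot all_order all_algebra all_field.
From mathcomp Require Import all_classical all_reals all_analysis.
From mathcomp Require Import zify ring lra.

Set Implicit Arguments.
Unset Strict Implicit.
Unset Printing Implicit Defensive.

Import Order.TTheory GRing.Theory Num.Theory.

(** For squarefree d, multiply the classes killed by g by the classes of the
    prime ideals above the split primes p <= Z.  A collision
    [I][P] = [I'][P'] forces (P P'^bar)^g to be principal, with a generator of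
    norm (p p')^g, hence 4 (p p')^g = u^2 + d v^2 with v prime to p p'.  By
    Cauchy-Schwarz, h_g(-d) M^2 <= h(-d) (M + E), where M counts the split primes
    and E counts the pairs p <> p' with such a representation.  For d in
    [N, 2N) and a given B, the equation B = t^2 + d w^2 with t prime to w forces
    w <= sqrt(B / N), and t is a square root of B modulo w^2 lying in an interval
    of length O(N w^2 / sqrt B); this bounds the sum of E over d by
    Z^2 (sqrt N + Z^g / sqrt N) N^eps.  A variance estimate shows that
    M >= pi(Z) / 6 for all but O(N / pi(Z) + Z^2) of the d, and for the others
    h_g(-d) <= h(-d) = O(N^(1/2 + eps)) suffices.  The choice Z = N^(3 / (2g + 2))
    balances the terms, and Z^3 <= N holds because g >= 5. *)

(** * The divisor function and the number of primes *)

(** Coprimality of t and w is what makes the count over d work: up to a bounded factor, the square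
    roots of B modulo w^2 that are prime to w are no more numerous than the divisors of w^2, whereas
    a common factor of t and w can allow about w of them. This is why p and p' must be kept out of
    v. Collisions with p = p' give no equation; there the prime ideal cancels, and at most one class
    collides. No group structure is built on the classes. Each class is handled through a chosen
    ideal, and h(-d) is bounded by the number of pairs (m, a) with a dividing m^2 + d that describe
    reduced lattices. The exponent of Z solves N / Z = Z^g / sqrt N, that is Z^(g+1) = N^(3/2); both
    sides are then N^(1 - 3/(2g+2)), which the factor N^(1/2) from h(-d) turns into the exponent of
    the theorem. *)

Lemma size_divisors_pfactor p a m : prime p -> 0 < m ->
  size (divisors (p ^ a * m)) <= a.+1 * size (divisors m).
Proof.
move=> pp m0; have p0 := prime_gt0 pp.
rewrite -(size_iota 0 a.+1) -(size_allpairs (fun i e => p ^ i * e)).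
apply: uniq_leq_size; first exact: divisors_uniq.
move=> e; rewrite -dvdn_divisors ?muln_gt0 ?expn_gt0 ?p0 // => e_dvd.
have e0 : 0 < e by apply: dvdn_gt0 e_dvd; rewrite muln_gt0 expn_gt0 p0.
(* [m] may still be divisible by [p], so [e] is split by its gcd with [p ^ a]. The cofactor [x] is
   prime to the quotient of [p ^ a] by that gcd, which forces [x %| m]. *)
have /dvdnP[x ex] := dvdn_gcdl e (p ^ a).
have /dvdn_pfactor-/(_ pp)[i lei ei] := dvdn_gcdr e (p ^ a).
apply/allpairsP; exists (i, x); split; [by rewrite mem_iota | | by rewrite /= mulnC -ei].
rewrite /= -dvdn_divisors //.
have g0 : 0 < gcdn e (p ^ a) by rewrite gcdn_gt0 e0.
have co : coprime x (p ^ a %/ gcdn e (p ^ a)).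
  by rewrite /coprime -(eqn_pmul2r g0) muln_gcdl -ex divnK ?dvdn_gcdr // mul1n.
by rewrite -(Gauss_dvdr _ co) -(dvdn_pmul2r g0) -ex mulnAC divnK ?dvdn_gcdr.
Qed.

(** Since [a + 1 <= k * (a %/ k + 1) <= k * 2 ^ (a %/ k)], the [k]-th power costs one factor [k ^ k]
    besides [2 ^ a]. *)
Lemma expn_succ_le k a : 0 < k -> a.+1 ^ k <= k ^ k * 2 ^ a.
Proof.
move=> k0.
have h1 : a.+1 <= k * 2 ^ (a %/ k).
  apply: (@leq_trans (k * (a %/ k).+1)); last by rewrite leq_mul2l ltn_expl ?orbT.
  by rewrite mulnC; apply: ltn_ceil.
apply: (@leq_trans ((k * 2 ^ (a %/ k)) ^ k)); first by rewrite leq_exp2r.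
by rewrite expnMn -expnM leq_mul2l leq_exp2l // leq_trunc_div orbT.
Qed.

Lemma size_divisors_expn_le_split k p n c A : prime p -> 0 < n -> 0 < k ->
  (forall a, a.+1 ^ k <= A * p ^ a) ->
  size (divisors (n %/ p ^ logn p n)) ^ k <= c * (n %/ p ^ logn p n) ->
  size (divisors n) ^ k <= A * c * n.
Proof.
move=> pp n0 k0 hA hm; set a := logn p n in hm; set m := n %/ p ^ a in hm.
have en : n = p ^ a * m by rewrite mulnC divnK // pfactor_dvdnn.
have m0 : 0 < m by move: n0; rewrite en muln_gt0 => /andP[].
rewrite en; apply: (@leq_trans ((a.+1 * size (divisors m)) ^ k)).
  by rewrite leq_exp2r // size_divisors_pfactor.
rewrite expnMn; apply: leq_trans (leq_mul (hA a) hm) _; lia.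
Qed.

(** Primes [p >= 2 ^ k] cost nothing, as [(a + 1) ^ k <= 2 ^ (k * a) <= p ^ a]. Each smaller prime
    is removed at the cost of one factor [k ^ k], and [j] bounds how many of these there can be. *)
Lemma size_divisors_expn_le_aux k j n : 0 < k -> 0 < n ->
  (forall p, prime p -> p %| n -> 2 ^ k <= p + j) ->
  size (divisors n) ^ k <= (k ^ k) ^ j * n.
Proof.
move=> k0; elim: j n => [|j IHj] n.
  elim/ltn_ind: n => n IHn n0 hn; rewrite expn0 mul1n.
  have [n1|n1] := leqP n 1.
    have -> : n = 1 by lia.
    by rewrite exp1n.
  have pp := pdiv_prime n1; set p := pdiv n in pp.
  have p1 := prime_gt1 pp.
  have a0 : 0 < logn p n by rewrite logn_gt0 mem_primes pp n0 pdiv_dvd.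
  have dvd := pfactor_dvdnn p n.
  have m0 : 0 < n %/ p ^ logn p n by rewrite divn_gt0 ?expn_gt0 ?(ltnW p1) // dvdn_leq.
  rewrite -[X in _ <= X]mul1n -[X in X * n]mul1n.
  apply: (size_divisors_expn_le_split pp) => //.
  - move=> a; rewrite mul1n; apply: (@leq_trans ((2 ^ k) ^ a)).
      by rewrite -expnM mulnC expnM leq_exp2r // ltn_expl.
    case: a => [|a]; first by rewrite !expn0.
    by rewrite leq_exp2r // -[p]addn0 hn // pdiv_dvd.
  - have := IHn (n %/ p ^ logn p n); rewrite expn0; apply => //.
      by rewrite ltn_Pdiv // -(exp1n (logn p n)) ltn_exp2r.
    move=> q pq qd; apply: hn => //; apply: dvdn_trans qd _.
    by apply/dvdnP; exists (p ^ logn p n); rewrite mulnC divnK.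
move=> n0 hn.
(* The only prime newly allowed when [j] grows by one; with its full power divided out, the
   induction hypothesis applies. *)
have [/andP[pp pn]|hp] := boolP (prime (2 ^ k - j.+1) && (2 ^ k - j.+1 %| n)).
  set p := 2 ^ k - j.+1 in pp pn *.
  have p1 := prime_gt1 pp.
  have dvd := pfactor_dvdnn p n.
  have m0 : 0 < n %/ p ^ logn p n by rewrite divn_gt0 ?expn_gt0 ?(ltnW p1) // dvdn_leq.
  rewrite expnS.
  apply: (size_divisors_expn_le_split pp) => //.
    move=> a; apply: leq_trans (expn_succ_le a k0) _.
    by rewrite leq_mul2l; case: a => [|a]; rewrite ?leqnn ?leq_exp2r ?p1 ?orbT.
  apply: IHj => // q pq qm.
  have qn : q %| n.
    apply: dvdn_trans qm _.
    by apply/dvdnP; exists (p ^ logn p n); rewrite mulnC divnK.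
  have := hn q pq qn; rewrite leq_eqVlt => /orP[/eqP e|]; last by lia.
  have qp : q = p by rewrite /p; lia.
  move: qm; rewrite qp => qm.
  have : p ^ (logn p n).+1 %| n.
    rewrite -[X in _ %| X](divnK dvd) expnS dvdn_pmul2r //.
  by rewrite pfactor_dvdn // ltnn.
apply: (@leq_trans ((k ^ k) ^ j * n)); last first.
  by rewrite leq_mul2r leq_pexp2l ?orbT // expn_gt0 k0.
apply: IHj => // q pq qn.
have := hn q pq qn; rewrite leq_eqVlt => /orP[/eqP e|]; last by lia.
have qp : q = 2 ^ k - j.+1 by lia.
by move: hp; rewrite -qp pq qn.
Qed.

Lemma size_divisors_expn_le k n : 0 < k -> 0 < n ->
  size (divisors n) ^ k <= (k ^ k) ^ (2 ^ k) * n.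
Proof.
by move=> k0 n0; apply: size_divisors_expn_le_aux => // p _ _; rewrite leq_addl.
Qed.

(** Legendre's formula with a free upper limit [M], so that the sums for [n] and [n.*2] can be
    compared term by term. *)
Lemma logn_fact_leq p n M : prime p -> n <= M ->
  logn p n`! = \sum_(1 <= k < M.+1) n %/ p ^ k.
Proof.
move=> pp leM; rewrite logn_fact //.
rewrite [RHS](big_cat_nat (n := n.+1)) //=.
rewrite [X in _ = _ + X]big_nat_cond [X in _ = _ + X]big1 ?addn0 // => k /andP[/andP[nk _] _].
by rewrite divn_small //; apply: leq_trans nk (ltnW (ltn_expl _ (prime_gt1 pp))).
Qed.

(** Each [p ^ k] contributes [n.*2 %/ p ^ k - 2 * (n %/ p ^ k)], which is at most 1, and nothing
    once [p ^ k > n.*2]; so the exponent is at most [trunc_log p n.*2]. *)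
Lemma logn_bin_central p n : prime p -> 0 < n -> p ^ logn p 'C(n.*2, n) <= n.*2.
Proof.
move=> pp n0; have p1 := prime_gt1 pp.
have le : logn p 'C(n.*2, n) <= trunc_log p n.*2.
  have := bin_fact (leq_addr n n); rewrite addnn -{2}addnn addnK.
  move/(congr1 (logn p)).
  rewrite !lognM ?fact_gt0 ?bin_gt0 ?muln_gt0 ?fact_gt0 -?addnn ?leq_addr //.
  rewrite addnn !(logn_fact_leq (M := n.*2)) -?addnn ?leq_addr // !addnn => e.
  have -> : trunc_log p n.*2 = \sum_(1 <= k < n.*2.+1) (p ^ k <= n.*2).
    have l2 : trunc_log p n.*2 <= n.*2.
      apply: leq_trans (ltnW (ltn_expl _ p1)) _.
      by apply: trunc_logP => //; rewrite double_gt0.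
    rewrite (big_cat_nat (n := (trunc_log p n.*2).+1)) //=.
    rewrite [X in _ = _ + X]big_nat_cond [X in _ = _ + X]big1 ?addn0; last first.
      move=> k /andP[/andP[nk _] _]; apply/eqP; rewrite eqb0 -ltnNge.
      by apply: leq_trans (trunc_log_ltn _ p1) _; rewrite leq_exp2l.
    rewrite big_nat_cond (eq_bigr (fun=> 1)) => [|k /andP[/andP[_ kt] _]].
      by rewrite -big_nat_cond sum_nat_const_nat muln1 subSS subn0.
    apply/eqP; rewrite eqb1; apply: leq_trans (trunc_logP p1 _) => //.
      by rewrite leq_exp2l.
    by rewrite double_gt0.
  rewrite -(leq_add2r ((\sum_(1 <= k < n.*2.+1) n %/ p ^ k).*2)) e.
  rewrite -[X in _ <= _ + X]addnn -!big_split /=; apply: leq_sum => k _.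
  have pk : 0 < p ^ k by rewrite expn_gt0 (ltnW p1).
  have [h|h] := leqP (p ^ k) n.*2; last by rewrite divn_small.
  rewrite add1n -ltnS.
  have := ltn_ceil n pk; have := leq_trunc_div n.*2 (p ^ k).
  move=> h1 h2; rewrite -(ltn_pmul2r pk); lia.
apply: leq_trans (_ : p ^ trunc_log p n.*2 <= _); first by rewrite leq_exp2l.
by apply: trunc_logP; rewrite ?double_gt0.
Qed.

Lemma bin_central_ge n : 2 ^ n <= 'C(n.*2, n).
Proof.
elim: n => // n IH; rewrite doubleS.
have -> : 'C(n.*2.+2, n.+1) = 'C(n.*2.+1, n.+1) * 2.
  rewrite binS -[X in _ + X]bin_sub ?muln2 -?addnn; last by lia.
  by have -> : (n + n).+1 - n = n.+1 by lia.
rewrite expnSr leq_mul2r /= binS; lia.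
Qed.

(** The central binomial coefficient is at least [2 ^ n], and it is a product of prime powers, each
    at most [n.*2], over distinct primes up to [n.*2]. *)
Lemma chebyshev_lower n : 0 < n ->
  2 ^ n <= n.*2 ^ size [seq p <- iota 0 n.*2.+1 | prime p].
Proof.
move=> n0; apply: leq_trans (bin_central_ge n) _.
have b0 : 0 < 'C(n.*2, n) by rewrite bin_gt0 -addnn leq_addr.
rewrite {1}(prod_prime_decomp b0) prime_decompE big_map.
apply: (@leq_trans (\prod_(p <- primes 'C(n.*2, n)) n.*2)).
  rewrite big_seq [X in _ <= X]big_seq; apply: leq_prod => p.
  by rewrite mem_primes => /and3P[pp _ _]; apply: logn_bin_central.
rewrite big_const_seq count_predT iter_muln_1 leq_pexp2l ?double_gt0 //.
apply: uniq_leq_size; first exact: primes_uniq.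
move=> p; rewrite mem_primes mem_filter mem_iota => /and3P[pp _ pd].
rewrite pp /= add0n ltnS; apply: leq_trans (logn_bin_central pp n0).
by rewrite -{1}(expn1 p) leq_exp2l ?prime_gt1 // -pfactor_dvdn // expn1.
Qed.

(** * Primitive representations by t^2 + d w^2 *)

(** A bounded search gives a boolean that can be summed over [d]; for positive [d] the bounds on [t]
    and [w] lose nothing, by [primitively_reprI]. *)
Definition primitively_repr (B d : nat) : bool :=
  has (fun w => has (fun t => coprime t w && (t ^ 2 + d * w ^ 2 == B)) (iota 0 B.+1))
    (iota 1 B).

Lemma primitively_reprI B d t w : 0 < d -> 0 < w -> coprime t w ->
  t ^ 2 + d * w ^ 2 = B -> primitively_repr B d.
Proof.
move=> d0 w0 co e; have le n : n <= n ^ 2 by rewrite -mulnn; case: n => // n; rewrite leq_pmull.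
have := le t; have : w <= d * w ^ 2 by apply: leq_trans (le w) _; rewrite leq_pmull.
move=> h1 h2.
apply/hasP; exists w; first by rewrite mem_iota w0 /=; lia.
apply/hasP; exists t; first by rewrite mem_iota; lia.
by rewrite co e eqxx.
Qed.

Lemma seq_maxP (s : seq nat) : s != [::] -> exists2 m, m \in s & {in s, forall x, x <= m}.
Proof.
elim: s => // x [|y s] IH _; first by exists x; rewrite ?mem_head // => z; rewrite inE => /eqP->.
have [//|m ms hm] := IH; have [le|lt] := leqP x m.
  exists m; first by rewrite inE ms orbT.
  by move=> z; rewrite inE => /orP[/eqP->|/hm].
exists x; first exact: mem_head.
by move=> z; rewrite inE => /orP[/eqP->//|/hm h]; apply: leq_trans h (ltnW lt).
Qed.

(* [t] modulo [w ^ 2 / 2] is determined by [gcdn (t0 - t) (w ^ 2)]. *)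
Lemma square_roots_gap (w t0 t1 t2 : nat) : 0 < w -> coprime t0 w ->
  t1 <= t2 -> t2 <= t0 -> w ^ 2 %| t0 ^ 2 - t1 ^ 2 -> w ^ 2 %| t0 ^ 2 - t2 ^ 2 ->
  gcdn (t0 - t1) (w ^ 2) = gcdn (t0 - t2) (w ^ 2) -> w ^ 2 %| 2 * (t2 - t1).
Proof.
move=> w0 co le12 le20 h1 h2 eg.
have w20 : 0 < w ^ 2 by rewrite expn_gt0 w0.
have le10 := leq_trans le12 le20.
set e := gcdn (t0 - t1) (w ^ 2) in eg.
have e0 : 0 < e by rewrite gcdn_gt0 w20 orbT.
have ew : e %| w ^ 2 by apply: dvdn_gcdr.
(* As [t0 ^ 2 - t ^ 2] is [(t0 - t) * (t0 + t)], the cofactor [f], being prime to [(t0 - t) / e],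
   has to divide [t0 + t]. *)
set f := w ^ 2 %/ e; have fw : f * e = w ^ 2 by rewrite divnK.
have f_dvd t : t <= t0 -> w ^ 2 %| t0 ^ 2 - t ^ 2 -> gcdn (t0 - t) (w ^ 2) = e -> f %| t0 + t.
  move=> le ht et; move: ht; rewrite subn_sqr -fw.
  have ed : e %| t0 - t by rewrite -et dvdn_gcdl.
  rewrite -{1}(divnK ed) mulnAC dvdn_pmul2r // Gauss_dvdr //.
  rewrite coprime_sym /coprime -(eqn_pmul2r e0) muln_gcdl divnK // divnK // et.
  by rewrite mul1n.
have f1 := f_dvd t1 le10 h1 erefl; have f2 := f_dvd t2 le20 h2 (esym eg).
have e1 : e %| t0 - t1 by apply: dvdn_gcdl.
have e2 : e %| t0 - t2 by rewrite eg dvdn_gcdl.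
have e12 : e %| t2 - t1.
  have -> : t2 - t1 = (t0 - t1) - (t0 - t2) by clear -le12 le20; lia.
  by rewrite dvdn_sub.
have f12 : f %| t2 - t1.
  have -> : t2 - t1 = (t0 + t2) - (t0 + t1) by clear; lia.
  by rewrite dvdn_sub.
(* A common divisor of [e] and [f] divides [t0 - t1] and [t0 + t1], hence [2 * t0]; dividing
   [w ^ 2], it is prime to [t0]. So [w ^ 2 = e * f] is [lcmn e f] up to a factor 2. *)
have g2 : gcdn e f %| 2.
  have d1 : gcdn e f %| (t0 - t1) + (t0 + t1).
    by rewrite dvdn_add // ?(dvdn_trans (dvdn_gcdl _ _) e1) // (dvdn_trans (dvdn_gcdr _ _) f1).
  have d2 : gcdn e f %| t0 * 2 by have <- : (t0 - t1) + (t0 + t1) = t0 * 2 by clear -le10; lia.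
  rewrite -(@Gauss_dvdr _ t0) //.
  have : coprime (w ^ 2) t0 by rewrite coprimeXl // coprime_sym.
  by apply: coprime_dvdl; apply: dvdn_trans (dvdn_gcdl _ _) ew.
rewrite -fw -muln_lcm_gcd lcmnC gcdnC mulnC dvdn_mul // dvdn_lcm.
by rewrite e12 f12.
Qed.

(** If [b <= 2 * t0], divide [t0 ^ 2 - t ^ 2 <= N * w ^ 2] by [t0 + t >= b / 2]. Otherwise [t0] is
    so small that [B] itself is of order [N * w ^ 2], and [t0 - t < b / 2] suffices. *)
Lemma window_gap (N B b w t0 t : nat) : t <= t0 -> b ^ 2 <= B -> t0 ^ 2 <= B ->
  B - t ^ 2 < 2 * (N * w ^ 2) -> N * w ^ 2 <= B - t0 ^ 2 -> 
  (t0 - t) * b <= 2 * (N * w ^ 2).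
Proof.
move=> le hb ht0 h1 h2; set M := N * w ^ 2 in h1 h2 *.
have [h|h] := leqP b (2 * t0).
  apply: (@leq_trans (2 * ((t0 - t) * (t0 + t)))).
    by apply: (@leq_trans ((t0 - t) * (2 * (t0 + t)))); [rewrite leq_mul2l; lia | lia].
  by rewrite -subn_sqr; lia.
have h3 : 4 * t0 ^ 2 <= b ^ 2 by rewrite -[4]/(2 ^ 2) -expnMn leq_sqr ltnW.
have h4 : t ^ 2 <= t0 ^ 2 by rewrite leq_sqr.
have : (t0 - t) * b * 2 <= b * b.
  rewrite mulnAC; apply: leq_mul => //; lia.
rewrite mulnn; lia.
Qed.

(** With [t0] the largest root in the window, [t] is determined by [gcdn (t0 - t) (w ^ 2)] and the
    quotient of [2 * (t0 - t)] by [w ^ 2]: by [square_roots_gap], distinct roots with the same gcd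
    have different quotients. [window_gap] bounds the quotient by [4 * N %/ b]. *)
Lemma window_roots_count (N B b w D : nat) : 0 < b -> b ^ 2 <= B -> 0 < w ->
  size (divisors (w ^ 2)) <= D ->
  size [seq t <- iota 0 B.+1 | [&& coprime t w, t ^ 2 <= B, w ^ 2 %| B - t ^ 2,
          N * w ^ 2 <= B - t ^ 2 & B - t ^ 2 < 2 * (N * w ^ 2)]]
   <= D * (4 * N %/ b).+1.
Proof.
move=> b0 hb w0 hD; set T := [seq t <- _ | _].
have w20 : 0 < w ^ 2 by rewrite expn_gt0 w0.
have [->//|T0] := eqVneq T [::].
have [t0 t0T max] := seq_maxP T0.
have TP t : t \in T -> [&& coprime t w, t ^ 2 <= B, w ^ 2 %| B - t ^ 2,
          N * w ^ 2 <= B - t ^ 2 & B - t ^ 2 < 2 * (N * w ^ 2)].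
  by rewrite mem_filter => /andP[].
have /and5P[co0 leB0 dv0 lo0 hi0] := TP _ t0T.
have dvd t : t \in T -> w ^ 2 %| t0 ^ 2 - t ^ 2.
  move=> tT; have /and5P[_ leB dv _ _] := TP _ tT.
  have : t ^ 2 <= t0 ^ 2 by rewrite leq_sqr max.
  move=> h; have -> : t0 ^ 2 - t ^ 2 = (B - t ^ 2) - (B - t0 ^ 2) by lia.
  by rewrite dvdn_sub.
apply: leq_trans (_ : size (divisors (w ^ 2)) * (4 * N %/ b).+1 <= _); last by rewrite leq_mul2r hD orbT.
rewrite -(size_iota 0 (4 * N %/ b).+1) -(size_allpairs pair).
rewrite -(size_map (fun t => (gcdn (t0 - t) (w ^ 2), (2 * (t0 - t)) %/ w ^ 2))).
apply: uniq_leq_size.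
  rewrite map_inj_in_uniq ?filter_uniq ?iota_uniq // => t1 t2 h1 h2 [eg eq].
  wlog le : t1 t2 h1 h2 eg eq / t1 <= t2.
    by move=> W; case/orP: (leq_total t1 t2) => h; [apply: W | symmetry; apply: W].
  have := @square_roots_gap w t0 t1 t2 w0 co0 le (max _ h2) (dvd _ h1) (dvd _ h2) eg.
  have [->//|lt] := eqVneq t1 t2.
  move=> hd; have := dvdn_leq _ hd; have := max _ h2 => m2.
  have -> : 0 < 2 * (t2 - t1) by lia.
  move=> /(_ isT) h.
  have : (2 * (t0 - t2)) %/ w ^ 2 < (2 * (t0 - t1)) %/ w ^ 2.
    rewrite leq_divRL // mulSn; have := leq_trunc_div (2 * (t0 - t2)) (w ^ 2).
    move: h; set x := _ %/ _ * _; move: x (w ^ 2) => x y; clear -le m2; lia.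
  by rewrite eq ltnn.
move=> _ /mapP[t tT ->]; apply/allpairsP.
exists (gcdn (t0 - t) (w ^ 2), (2 * (t0 - t)) %/ w ^ 2); split => //.
  by rewrite /= -dvdn_divisors // dvdn_gcdr.
rewrite mem_iota add0n ltnS leq_divRL //=.
have /and5P[_ leB dv lo hi] := TP _ tT.
have := window_gap (max _ tT) hb leB0 hi lo0.
have := leq_trunc_div (2 * (t0 - t)) (w ^ 2).
set q := _ %/ _; move=> h1 h2.
rewrite -(leq_pmul2r w20) mulnAC.
apply: (@leq_trans (2 * (t0 - t) * b)); first by rewrite leq_mul2r h1 orbT.
by move: h2; move: (t0 - t) (w ^ 2) => x y; clear; lia.
Qed.

(** As [d] is [(B - t ^ 2) / w ^ 2], it suffices to count pairs [(w, t)]. The hypothesis on [W] and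
    [N <= d] give [w <= W], and the range of [d] puts [t] in the window of [window_roots_count]. *)
Lemma primitively_repr_count (N B b W D : nat) : 0 < b -> b ^ 2 <= B ->
  B < N * W.+1 ^ 2 -> (forall n, 0 < n <= B -> size (divisors n) <= D) ->
  \sum_(N <= d < N + N) primitively_repr B d <= W * (D * (4 * N %/ b).+1).
Proof.
move=> b0 hb hW hD.
pose T w := [seq t <- iota 0 B.+1 | [&& coprime t w, t ^ 2 <= B, w ^ 2 %| B - t ^ 2,
          N * w ^ 2 <= B - t ^ 2 & B - t ^ 2 < 2 * (N * w ^ 2)]].
have -> : \sum_(N <= d < N + N) primitively_repr B d =
    size [seq d <- index_iota N (N + N) | primitively_repr B d].
  rewrite size_filter -sum1_count [RHS]big_mkcond /=.
  by apply: eq_bigr => d _; case: (primitively_repr B d).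
apply: (@leq_trans (size [seq (B - t ^ 2) %/ w ^ 2 | w <- iota 1 W, t <- T w])).
  apply: uniq_leq_size; first by rewrite filter_uniq // iota_uniq.
  move=> d; rewrite mem_filter mem_index_iota => /andP[/hasP[w wi /hasP[t ti /andP[co /eqP e]]] /andP[d1 d2]].
  move: wi; rewrite mem_iota => /andP[w0 wB].
  have w20 : 0 < w ^ 2 by rewrite expn_gt0 w0.
  apply/allpairsPdep; exists w, t; split.
  - rewrite mem_iota w0 add1n.
    have h : N * w ^ 2 < N * W.+1 ^ 2.
      apply: leq_ltn_trans hW; rewrite -e; apply: leq_trans (leq_addl _ _).
      by rewrite leq_mul2r d1 orbT.
    by move: h; rewrite ltn_mul2l => /andP[_]; rewrite ltn_sqr.
  - rewrite mem_filter ti andbT co.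
    have -> : B - t ^ 2 = d * w ^ 2 by lia.
    rewrite dvdn_mull // leq_mul2r d1 orbT mulnA ltn_mul2r w20 /=.
    by apply/andP; split; lia.
  - have -> : B - t ^ 2 = d * w ^ 2 by lia.
    by rewrite mulnK.
rewrite size_allpairs_dep sumnE big_map.
apply: (@leq_trans (\sum_(w <- iota 1 W) D * (4 * N %/ b).+1)); last first.
  by rewrite big_const_seq count_predT iter_addn_0 size_iota mulnC.
rewrite big_seq [X in _ <= X]big_seq; apply: leq_sum => w; rewrite mem_iota => /andP[w0 wW].
(* The divisor bound [hD] covers arguments up to [B] only; for [w ^ 2 > B] there is no root to
   count. *)
have [le|lt] := leqP (w ^ 2) B.
  by apply: window_roots_count => //; apply: hD; rewrite expn_gt0 w0.
have -> : T w = [::]; last by [].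
apply/eqP; rewrite -[_ == _]negbK -has_filter -all_predC; apply/allP => t _ /=.
apply/negP => /and5P[_ leB dv lo hi].
have [z|z] := posnP (B - t ^ 2); first by move: hi lo; rewrite z; lia.
have := dvdn_leq z dv; lia.
Qed.

(** * Split primes on average *)

Definition odd_primes (Z : nat) : seq nat :=
  [seq p <- iota 0 Z.+1 | prime p && (2 < p)].

Definition splits (d p : nat) : bool :=
  ~~ (p %| d) && has (fun m => p %| m ^ 2 + d) (iota 0 p).

Definition num_splits (Z d : nat) : nat := count (splits d) (odd_primes Z).

Definition split_residues (p : nat) : nat := \sum_(0 <= d < p) splits d p.

Lemma splits_addl d p k : splits (p * k + d) p = splits d p.
Proof.
rewrite /splits dvdn_addr ?dvdn_mulr //; congr (_ && _); apply: eq_has => m.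
by rewrite addnCA dvdn_addr ?dvdn_mulr.
Qed.

Lemma splits_mod d p : splits (d %% p) p = splits d p.
Proof. by rewrite {2}(divn_eq d p) mulnC splits_addl. Qed.

(** The residues [- m ^ 2] for [1 <= m <= (p - 1) / 2] are distinct and split, and
    [(p - 1) / 2 >= p / 3] for [p >= 3]. *)
Lemma split_residues_ge p : prime p -> 2 < p -> p <= 3 * split_residues p.
Proof.
move=> pp p2; have p0 := prime_gt0 pp.
have half : (p./2).*2.+1 = p.
  by have := odd_double_half p; have -> : odd p by case: (even_prime pp) p2 => [->|].
suff : p./2 <= split_residues p by lia.
have -> : split_residues p = size [seq d <- iota 0 p | splits d p].
  rewrite size_filter -sum1_count /split_residues /index_iota subn0 [RHS]big_mkcond /=.
  by apply: eq_bigr => d _; case: (splits d p).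
rewrite -(size_iota 1 p./2) -(size_map (fun m => p - m ^ 2 %% p)).
have p_m m : m \in iota 1 p./2 -> ~~ (p %| m ^ 2).
  rewrite mem_iota => /andP[m1 mp]; rewrite Euclid_dvdX // andbT gtnNdvd //; lia.
apply: uniq_leq_size.
  rewrite map_inj_in_uniq ?iota_uniq // => m1 m2 h1 h2 e.
  have l1 := ltn_pmod (m1 ^ 2) p0; have l2 := ltn_pmod (m2 ^ 2) p0.
  have {l1 l2}e : m1 ^ 2 = m2 ^ 2 %[mod p] by lia.
  move: h1 h2; rewrite !mem_iota => /andP[h1 h1'] /andP[h2 h2'].
  wlog lem : m1 m2 e h1 h1' h2 h2' / m1 <= m2.
    by move=> W; case/orP: (leq_total m1 m2) => h; [apply: W | symmetry; apply: W].
  have /eqP := e; rewrite eq_sym eqn_mod_dvd ?leq_sqr // subn_sqr Euclid_dvdM //.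
  case/orP => h.
    have [|lt] := leqP m2 m1; first by lia.
    by move: h; rewrite gtnNdvd //; lia.
  by move: h; rewrite gtnNdvd //; lia.
move=> d /mapP[m mi ->]; rewrite mem_filter mem_iota /=.
have := p_m _ mi; rewrite /dvdn -lt0n => h.
have lt := ltn_pmod (m ^ 2) p0.
apply/andP; split; last by lia.
apply/andP; split; first by rewrite gtnNdvd //; lia.
apply/hasP; exists m.
  by move: mi; rewrite !mem_iota; lia.
rewrite {1}(divn_eq (m ^ 2) p) -addnA dvdn_addr ?dvdn_mull //.
by rewrite subnKC // ltnW.
Qed.

Local Open Scope ring_scope.

Lemma sum_periodic_shift (R : pzRingType) (f : nat -> R) (m a : nat) :
  (forall d, f (m + d)%N = f d) ->
  \sum_(a <= d < a + m) f d = \sum_(0 <= d < m) f d.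
Proof.
move=> fm; elim: a => // a <-.
have [->|m0] := posnP m; first by rewrite !addn0 !big_geq.
rewrite addSn big_nat_recr; last by lia.
rewrite [RHS]big_ltn; last by lia.
by rewrite /= addrC [(a + m)%N]addnC fm.
Qed.

(** Full periods sum to zero, so fewer than [m] terms remain. *)
Lemma norm_sum_periodic_le (R : numDomainType) (f : nat -> R) (m a n : nat) :
  (0 < m)%N -> (forall d, f (m + d)%N = f d) -> \sum_(0 <= d < m) f d = 0 ->
  (forall d, `|f d| <= 1) -> `|\sum_(a <= d < a + n) f d| <= m%:R.
Proof.
move=> m0 fm s0 f1; elim/ltn_ind: n a => n IH a.
have [nm|nm] := ltnP n m.
  apply: le_trans (ler_norm_sum _ _ _) _.
  apply: le_trans (ler_sum _ (fun d _ => f1 d)) _.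
  by rewrite sumr_const_nat addKn ler_nat ltnW.
rewrite (big_cat_nat (n := (a + m)%N)) ?leq_addr ?leq_add2l //=.
rewrite sum_periodic_shift // s0 add0r.
have -> : (a + n = a + m + (n - m))%N by lia.
by apply: IH; lia.
Qed.

(** Centred at its mean over a period, so that distinct primes are almost uncorrelated on [[N, 2N)];
    see [split_dev_corr]. *)
Definition split_dev (p d : nat) : rat :=
  (splits d p)%:R - (split_residues p)%:R / p%:R.

Lemma split_dev_periodic p d k : split_dev p (p * k + d) = split_dev p d.
Proof. by rewrite /split_dev splits_addl. Qed.

Lemma sum_split_dev p : (0 < p)%N -> \sum_(0 <= d < p) split_dev p d = 0.
Proof.
move=> p0; rewrite sumrB sumr_const_nat subn0 -natr_sum -/(split_residues p).
by rewrite -[X in _ - X]mulr_natr divfK ?subrr // pnatr_eq0 -lt0n.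
Qed.

Lemma norm_split_dev_le p d : (0 < p)%N -> `|split_dev p d| <= 1.
Proof.
move=> p0; rewrite /split_dev.
have h0 : 0 <= (split_residues p)%:R / p%:R :> rat by rewrite divr_ge0.
have h1 : (split_residues p)%:R / p%:R <= 1 :> rat.
  rewrite ler_pdivrMr ?ltr0n // mul1r ler_nat /split_residues.
  apply: leq_trans (leq_sum (E2 := fun=> 1%N) _ _) _ => [i _|].
    by case: (splits i p).
  by rewrite sum_nat_const_nat subn0 muln1.
by rewrite ler_norml; case: (splits d p) => /=; lra.
Qed.

(** Chinese remaindering: with [d = p * j + i], the value [f d] depends on [i] only, and as [j] runs
    over the residues modulo [q], so does [p * j + i]. *)
Lemma sum_mul_coprime (R : pzRingType) (f h : nat -> R) (p q : nat) :
  (0 < q)%N -> coprime p q -> (forall d k, f (p * k + d)%N = f d) ->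
  (forall d, h (d %% q)%N = h d) ->
  \sum_(0 <= d < p * q) f d * h d =
  (\sum_(0 <= d < p) f d) * (\sum_(0 <= d < q) h d).
Proof.
move=> q0 co fp hq.
transitivity (\sum_(0 <= j < q) \sum_(0 <= i < p) f i * h (p * j + i)%N).
  elim: {q0 co hq}q => [|q IH]; first by rewrite muln0 !big_geq.
  rewrite mulnS addnC (big_cat_nat (n := (p * q)%N)) ?leq_addr //= IH big_nat_recr //=.
  congr (_ + _); rewrite -{1}[(p * q)%N]add0n big_addn addKn.
  by apply: eq_bigr => i _; rewrite addnC fp.
rewrite exchange_big /= mulr_suml; apply: eq_bigr => i _.
rewrite -mulr_sumr; congr (_ * _).
rewrite !big_mkord.
case: q q0 co hq => // q _ co hq.
have inj : injective (fun j : 'I_q.+1 => inord ((p * j + i) %% q.+1) : 'I_q.+1).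
  move=> j1 j2 /(congr1 val) /=; rewrite !inordK ?ltn_pmod // => /eqP.
  rewrite eqn_modDr => /eqP e; apply/val_inj => /=.
  wlog lej : j1 j2 e / (j1 <= j2)%N.
    by move=> W; case/orP: (leq_total j1 j2) => hj; [apply: W | symmetry; apply: W].
  have /eqP := e; rewrite eq_sym eqn_mod_dvd ?leq_mul2l ?lej ?orbT //.
  rewrite -mulnBr Gauss_dvdr 1?coprime_sym // => hd.
  have [|lt] := leqP j2 j1; first by lia.
  by move: hd; rewrite gtnNdvd //; have := ltn_ord j2; lia.
rewrite [RHS](reindex_inj inj); apply: eq_bigr => j _ /=.
by rewrite inordK ?ltn_pmod // hq.
Qed.

Lemma odd_primesP Z p : p \in odd_primes Z -> [/\ prime p, (2 < p)%N & (p <= Z)%N].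
Proof. by rewrite mem_filter mem_iota add0n ltnS => /andP[/andP[-> ->] /andP[_ ->]]. Qed.

Lemma split_dev_corr p q N : prime p -> prime q -> p != q ->
  `|\sum_(N <= d < N + N) split_dev p d * split_dev q d| <= (p * q)%:R.
Proof.
move=> pp pq neq; have p0 := prime_gt0 pp; have q0 := prime_gt0 pq.
apply: norm_sum_periodic_le; first by rewrite muln_gt0 p0.
- by move=> d; rewrite split_dev_periodic mulnC split_dev_periodic.
- rewrite sum_mul_coprime // ?sum_split_dev ?mul0r //.
  + by rewrite prime_coprime // dvdn_prime2.
  + by move=> d k; rewrite split_dev_periodic.
  + by move=> d; rewrite /split_dev splits_mod.
- by move=> d; rewrite normrM mulr_ile1 ?norm_split_dev_le.
Qed.

(** After expanding the square, each of the [size s] diagonal terms is at most [N], and each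
    off-diagonal one at most [p * q <= Z ^ 2] by [split_dev_corr]. *)
Lemma second_moment Z N (s := odd_primes Z) :
  \sum_(N <= d < N + N) (\sum_(p <- s) split_dev p d) ^+ 2
    <= (size s * N + size s ^ 2 * Z ^ 2)%:R.
Proof.
under eq_bigr do rewrite expr2 mulr_suml.
under eq_bigr do under eq_bigr do rewrite mulr_sumr.
rewrite exchange_big /=.
apply: (@le_trans _ _ (\sum_(p <- s) (N + size s * Z ^ 2)%:R)); last first.
  by rewrite big_const_seq count_predT iter_addr_0 -[X in X <= _]mulr_natr -natrM ler_nat; lia.
rewrite big_seq [X in _ <= X]big_seq; apply: ler_sum => p ps.
have [pp p2 pZ] := odd_primesP ps; have p0 := prime_gt0 pp.
rewrite exchange_big /= (bigD1_seq p) ?filter_uniq ?iota_uniq //=.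
rewrite natrD lerD //.
  apply: (@le_trans _ _ (\sum_(N <= d < N + N) 1)); last by rewrite sumr_const_nat addKn.
  apply: ler_sum => d _; apply: le_trans (ler_norm _) _.
  by rewrite normrM mulr_ile1 ?norm_split_dev_le.
apply: (@le_trans _ _ (\sum_(q <- s) (Z ^ 2)%:R)); last first.
  by rewrite big_const_seq count_predT iter_addr_0 -[X in X <= _]mulr_natr -natrM ler_nat; lia.
rewrite big_mkcond big_seq [X in _ <= X]big_seq; apply: ler_sum => q qs.
have [pq q2 qZ] := odd_primesP qs.
case: ifP => [qp|_]; last by rewrite ler0n.
apply: le_trans (ler_norm _) _; apply: le_trans (split_dev_corr _ _ _ _) _ => //.
  by rewrite eq_sym.
by rewrite ler_nat expnS expn1 leq_mul.
Qed.

(** Chebyshev's inequality: the mean number of split primes is at least [size s / 3], so having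
    fewer than [size s / 6] means a deviation of at least [size s / 6], whence the 36. *)
Lemma few_unsplit Z N (s := odd_primes Z) :
  (size s ^ 2 * \sum_(N <= d < N + N) (6 * num_splits Z d < size s)
     <= 36 * (size s * N + size s ^ 2 * Z ^ 2))%N.
Proof.
rewrite -(ler_nat rat) [X in _ <= X]natrM.
have m2 : 36%:R * (\sum_(N <= d < N + N) (\sum_(p <- s) split_dev p d) ^+ 2) <=
    36%:R * (size s * N + size s ^ 2 * Z ^ 2)%:R by apply: ler_wpM2l (second_moment Z N).
apply: le_trans m2.
rewrite natrM natr_sum !mulr_sumr; apply: ler_sum => d _.
case: ltnP => h; last by rewrite mulr0 mulr_ge0 // sqr_ge0.
rewrite mulr1.
have e : \sum_(p <- s) split_dev p d <= (num_splits Z d)%:R - (size s)%:R / 3.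
  rewrite sumrB; apply: lerB.
    rewrite /num_splits -natr_sum ler_nat -/s -sum1_count [X in (_ <= X)%N]big_mkcond /=.
    by apply: leq_sum => p _; case: (splits d p).
  have -> : (size s)%:R * 3^-1 = \sum_(p <- s) 3^-1 :> rat.
    by rewrite big_const_seq count_predT iter_addr_0 mulr_natl.
  rewrite big_seq [X in _ <= X]big_seq; apply: ler_sum => p ps.
  have [pp p2 pZ] := odd_primesP ps; have p0 := prime_gt0 pp.
  rewrite ler_pdivlMr ?ltr0n // ler_pdivrMl // -natrM ler_nat.
  exact: split_residues_ge.
move: h; rewrite -(ltr_nat rat) natrM natrX => h.
set T := \sum_(p <- s) _ in e *.
have s0 : 0 <= (size s)%:R :> rat by [].
have hx : (size s)%:R <= - (6 * T) by lra.
have -> : 36%:R * T ^+ 2 = (- (6 * T)) ^+ 2 by ring.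
have h0 := le_trans s0 hx.
by apply: lerXn2r; [exact: s0 | exact: h0 | exact: hx].
Qed.

Local Open Scope classical_set_scope.
Local Open Scope ring_scope.

(** * Integers of Q(sqrt(-d)) *)

Definition sqrtN (d : nat) : algC := sqrtC (- d%:R).
Local Notation "''s_' d" := (sqrtN d) (at level 8, d at level 2, format "''s_' d").
Local Notation conj := Num.conj.

Lemma QsqrtP d z : Qsqrt d z <-> exists a b : rat, z = ratr a + ratr b * 's_d.
Proof. by []. Qed.

Lemma sqrtCN_sqr d : 's_d ^+ 2 = - d%:R. Proof. exact: sqrtCK. Qed.

Lemma sqrtCN_neq0 d : (0 < d)%N -> 's_d != 0.
Proof. by move=> d0; rewrite sqrtC_eq0 oppr_eq0 pnatr_eq0 -lt0n. Qed.

(** The conjugate has the same square, so it is ['s_d] up to sign; the plus sign would make ['s_d]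
    real with a negative square. *)
Lemma conj_sqrtCN d : (0 < d)%N -> conj 's_d = - 's_d.
Proof.
move=> d0; have : conj 's_d ^+ 2 = 's_d ^+ 2.
  by rewrite -rmorphXn sqrtCN_sqr rmorphN rmorph_nat.
move/eqP; rewrite eqf_sqr => /orP[|/eqP//].
rewrite -CrealE => sr; have := real_exprn_even_ge0 (n := 2) sr isT.
by rewrite sqrtCN_sqr oppr_ge0 lern0; case: (d) d0.
Qed.

Lemma conj_ratr (a : rat) : conj (ratr a) = ratr a :> algC.
Proof. by rewrite conj_Crat // Crat_rat. Qed.

Lemma conj_quad d (a b : rat) : (0 < d)%N ->
  conj (ratr a + ratr b * 's_d) = ratr a - ratr b * 's_d.
Proof. by move=> d0; rewrite rmorphD /= conj_ratr rmorphM /= conj_ratr conj_sqrtCN // mulrN. Qed.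

Lemma quad_inj d (a b a' b' : rat) : (0 < d)%N ->
  ratr a + ratr b * 's_d = ratr a' + ratr b' * 's_d -> a = a' /\ b = b'.
Proof.
move=> d0 e; have := congr1 conj e; rewrite !conj_quad // => e'.
have ea : ratr a = ratr a' :> algC.
  have : ratr a *+ 2 = ratr a' *+ 2 :> algC.
    transitivity ((ratr a + ratr b * 's_d) + (ratr a - ratr b * 's_d)); first by ring.
    by rewrite e e'; ring.
  by move/eqP; rewrite eqrMn2r => /eqP.
split; first exact: fmorph_inj ea.
move: e; rewrite ea => /addrI /(mulIf (sqrtCN_neq0 d0)); exact: fmorph_inj.
Qed.

Lemma mul_conj_quad d (a b : rat) : (0 < d)%N ->
  (ratr a + ratr b * 's_d) * conj (ratr a + ratr b * 's_d) = ratr (a ^+ 2 + d%:R * b ^+ 2).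
Proof.
move=> d0; rewrite conj_quad // !(rmorphD, rmorphM, rmorphXn, rmorph_nat) /=.
have := sqrtCN_sqr d; move: 's_d => s hs.
have -> : d%:R = - s ^+ 2 :> algC by rewrite hs opprK.
by ring.
Qed.

Lemma Qsqrt_rat d (a : rat) : Qsqrt d (ratr a).
Proof. by apply/QsqrtP; exists a, 0; rewrite rmorph0 mul0r addr0. Qed.

Lemma Qsqrt_int d (n : int) : Qsqrt d n%:~R.
Proof. by rewrite -ratr_int; apply: Qsqrt_rat. Qed.

Lemma Qsqrt_nat d (n : nat) : Qsqrt d n%:R.
Proof. exact: (Qsqrt_int d n). Qed.

Lemma Qsqrt_sqrtCN d : Qsqrt d 's_d.
Proof. by apply/QsqrtP; exists 0, 1; rewrite rmorph0 rmorph1 mul1r add0r. Qed.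

Lemma QsqrtD d x y : Qsqrt d x -> Qsqrt d y -> Qsqrt d (x + y).
Proof.
move=> /QsqrtP[a [b ->]] /QsqrtP[a' [b' ->]]; apply/QsqrtP.
by exists (a + a'), (b + b'); rewrite !rmorphD; ring.
Qed.

Lemma QsqrtM d x y : Qsqrt d x -> Qsqrt d y -> Qsqrt d (x * y).
Proof.
move=> /QsqrtP[a [b ->]] /QsqrtP[a' [b' ->]]; apply/QsqrtP; exists (a * a' - d%:R * b * b'), (a * b' + b * a').
rewrite rmorphB rmorphD !rmorphM rmorph_nat.
have := sqrtCN_sqr d; move: 's_d => s hs.
have -> : d%:R = - s ^+ 2 :> algC by rewrite hs opprK.
by ring.
Qed.

Lemma Qsqrt_conj d x : (0 < d)%N -> Qsqrt d x -> Qsqrt d (conj x).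
Proof.
by move=> d0 /QsqrtP[a [b ->]]; apply/QsqrtP; exists a, (- b); rewrite conj_quad // rmorphN mulNr.
Qed.

Lemma QsqrtV d x : (0 < d)%N -> Qsqrt d x -> Qsqrt d x^-1.
Proof.
move=> d0 Qx; have [->|x0] := eqVneq x 0; first by rewrite invr0; apply: (Qsqrt_nat d 0).
have -> : x^-1 = conj x * (x * conj x)^-1.
  by rewrite invfM mulrCA mulfV ?mulr1 // fmorph_eq0.
apply: QsqrtM; first exact: Qsqrt_conj.
have /QsqrtP[a [b ->]] := Qx; rewrite mul_conj_quad // -fmorphV; exact: Qsqrt_rat.
Qed.

Local Notation Oint := ring_of_integers.

Lemma OintD d x y : Oint d x -> Oint d y -> Oint d (x + y).
Proof. by move=> [? ?] [? ?]; split; [exact: QsqrtD | exact: rpredD]. Qed.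

Lemma OintM d x y : Oint d x -> Oint d y -> Oint d (x * y).
Proof. by move=> [? ?] [? ?]; split; [exact: QsqrtM | exact: rpredM]. Qed.

Lemma Oint_int d (n : int) : Oint d n%:~R.
Proof. by split; [exact: Qsqrt_int | exact: Aint_int]. Qed.

Lemma Oint_nat d (n : nat) : Oint d n%:R.
Proof. exact: (Oint_int d n). Qed.

Lemma Oint0 d : Oint d 0. Proof. exact: (Oint_nat d 0). Qed.
Lemma Oint1 d : Oint d 1. Proof. exact: (Oint_nat d 1). Qed.

Lemma OintN d x : Oint d x -> Oint d (- x).
Proof. by move=> Ox; rewrite -mulN1r; apply: OintM => //; exact: (Oint_int d (-1)). Qed.

Lemma OintB d x y : Oint d x -> Oint d y -> Oint d (x - y).
Proof. by move=> Ox Oy; apply: OintD => //; exact: OintN. Qed.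

Lemma Oint_sqrtCN d : Oint d 's_d.
Proof.
split; first exact: Qsqrt_sqrtCN.
apply: (@root_monic_Aint ('X^2 + d%:R%:P)).
- by rewrite /root !hornerE sqrtCN_sqr addNr.
- by rewrite monicE lead_coefDl ?lead_coefXn // size_polyXn ltnS (leq_trans (size_polyC_leq1 _)).
- apply/polyOverP => i; rewrite coefD coefXn coefC.
  by case: ifP => _; rewrite ?addr0 -?natrD; exact: natr_int.
Qed.

Lemma Oint_conj d x : (0 < d)%N -> Oint d x -> Oint d (conj x).
Proof. by move=> d0 [? ?]; split; [exact: Qsqrt_conj | rewrite /= Aint_aut]. Qed.

Lemma Oint_rat d (a : rat) : Oint d (ratr a) -> a \is a Num.int.
Proof. by move=> [_ Aa]; rewrite -Cint_rat; apply: Cint_rat_Aint => //; exact: Crat_rat. Qed.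

Lemma Oint_quad d (a b : rat) : (0 < d)%N -> Oint d (ratr a + ratr b * 's_d) ->
  2 * a \is a Num.int /\ a ^+ 2 + d%:R * b ^+ 2 \is a Num.int.
Proof.
move=> d0 O; have Oc := Oint_conj d0 O; split; apply: (@Oint_rat d).
  have -> : ratr (2 * a) = (ratr a + ratr b * 's_d) + conj (ratr a + ratr b * 's_d) :> algC.
    by rewrite conj_quad // rmorphM rmorph_nat; ring.
  exact: OintD.
by rewrite -mul_conj_quad //; apply: OintM.
Qed.

(** The squared denominator of [c] is prime to the squared numerator, hence divides [d]. *)
Lemma squarefree_mul_sqr_int (d : nat) (c : rat) : squarefree d ->
  d%:R * c ^+ 2 \is a Num.int -> c \is a Num.int.
Proof.
move=> sq /intrP[k e]; rewrite Qint_def.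
have dn0 : (denq c)%:~R != 0 :> rat by rewrite intr_eq0 denq_eq0.
have e2 : (d%:Z * numq c ^+ 2 = k * denq c ^+ 2)%R.
  apply: (@intr_inj rat); rewrite !expr2 !intrM -e.
  have -> : (numq c)%:~R = c * (denq c)%:~R by rewrite -{2}(divq_num_den c) divfK.
  by rewrite -[(Posz d)%:~R]/(d%:R : rat); ring.
move/(congr1 absz): e2; rewrite [in LHS]abszM abszX [in RHS]abszM abszX absz_nat => e2.
have h : (`|denq c| ^ 2 %| d)%N.
  have co : coprime (`|denq c| ^ 2)%N (`|numq c| ^ 2)%N.
    by rewrite coprimeXl // coprimeXr // coprime_sym coprime_num_den.
  by rewrite -(Gauss_dvdl _ co) e2 dvdn_mull.
have := sq _ h; have := denq_gt0 c; case: (denq c) => // n _; rewrite absz_nat => ->.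
by [].
Qed.

(** Trace [2 * a] and norm are integers, and [d * (2 * b) ^ 2] is four times the norm minus the
    squared trace. Keeping the factor 2 avoids a case split on [d] modulo 4. *)
Lemma Oint_half d z : (0 < d)%N -> squarefree d -> Oint d z ->
  exists u v : int, 2 * z = u%:~R + v%:~R * 's_d.
Proof.
move=> d0 sq Oz; have [/QsqrtP[a [b ez]] _] := Oz; rewrite ez in Oz *.
have [ia ib] := Oint_quad d0 Oz.
have ic : 2 * b \is a Num.int.
  apply: (squarefree_mul_sqr_int sq).
  have -> : d%:R * (2 * b) ^+ 2 = 4 * (a ^+ 2 + d%:R * b ^+ 2) - (2 * a) ^+ 2 by ring.
  by apply: rpredB; [apply: rpredM => //; exact: natr_int | exact: rpredX].
have /intrP[u eu] := ia; have /intrP[v ev] := ic; exists u, v.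
have -> : 2 * (ratr a + ratr b * 's_d) = ratr (2 * a) + ratr (2 * b) * 's_d.
  by rewrite !rmorphM rmorph_nat; ring.
by rewrite eu ev !ratr_int.
Qed.

(** * The monoid of fractional ideals *)

Lemma ideal_mul0 (I J : set algC) : ideal_mul I J 0.
Proof. by exists [::]; rewrite ?big_nil. Qed.

Lemma ideal_mulD (I J : set algC) x y :
  ideal_mul I J x -> ideal_mul I J y -> ideal_mul I J (x + y).
Proof.
move=> [s hs ->] [t ht ->]; exists (s ++ t); last by rewrite big_cat.
by move=> p; rewrite mem_cat => /orP[/hs|/ht].
Qed.

Lemma ideal_mul_mem (I J : set algC) x y : I x -> J y -> ideal_mul I J (x * y).
Proof.
by move=> Ix Jy; exists [:: (x, y)]; rewrite ?big_seq1 // => p; rewrite inE => /eqP->.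
Qed.

(** Serves as the induction principle for products, in place of reasoning on the finite sums. *)
Lemma ideal_mul_sub (I J K : set algC) : K 0 -> (forall x y, K x -> K y -> K (x + y)) ->
  (forall x y, I x -> J y -> K (x * y)) -> ideal_mul I J `<=` K.
Proof.
move=> K0 KD KM _ [s hs ->]; elim: s hs => [|p s IH] hs; first by rewrite big_nil.
rewrite big_cons; apply: KD.
  by have [|? ?] := hs p; rewrite ?mem_head //; apply: KM.
by apply: IH => q qs; apply: hs; rewrite inE qs orbT.
Qed.

Lemma ideal_mulC (I J : set algC) : ideal_mul I J = ideal_mul J I.
Proof.
apply/seteqP; split; apply: ideal_mul_sub; try exact: ideal_mul0; try exact: ideal_mulD;
  by move=> x y Ix Jy; rewrite mulrC; apply: ideal_mul_mem.
Qed.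

Lemma ideal_mulA (I J K : set algC) :
  ideal_mul I (ideal_mul J K) = ideal_mul (ideal_mul I J) K.
Proof.
apply/seteqP; split; apply: ideal_mul_sub; try exact: ideal_mul0; try exact: ideal_mulD.
- move=> x y Ix.
  apply: (ideal_mul_sub (K := [set y | ideal_mul (ideal_mul I J) K (x * y)])) => /=.
  + by rewrite mulr0; exact: ideal_mul0.
  + by move=> u v hu hv; rewrite mulrDr; exact: ideal_mulD.
  + by move=> u v Ju Kv; rewrite mulrA; do 2!apply: ideal_mul_mem => //.
- move=> x y xIJ Ky; move: x xIJ.
  apply: (ideal_mul_sub (K := [set x | ideal_mul I (ideal_mul J K) (x * y)])) => /=.
  + by rewrite mul0r; exact: ideal_mul0.
  + by move=> u v hu hv; rewrite mulrDl; exact: ideal_mulD.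
  + by move=> u v Ju Kv; rewrite -mulrA; do 2!apply: ideal_mul_mem => //.
Qed.

Lemma ideal_mulACA (I J K L : set algC) :
  ideal_mul (ideal_mul I J) (ideal_mul K L) = ideal_mul (ideal_mul I K) (ideal_mul J L).
Proof. by rewrite ideal_mulA -(ideal_mulA I) (ideal_mulC J) !ideal_mulA. Qed.

Definition scale (x : algC) (I : set algC) : set algC := [set x * y | y in I].

Lemma scale1 I : scale 1 I = I.
Proof.
by apply/seteqP; split=> [_ [y Iy <-]|y Iy]; rewrite ?mul1r //; exists y; rewrite ?mul1r.
Qed.

Lemma scaleM x y I : scale (x * y) I = scale x (scale y I).
Proof.
apply/seteqP; split=> [_ [z Iz <-]|_ [_ [z Iz <-] <-]].
  by exists (y * z); [exists z | rewrite mulrA].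
by exists z; rewrite ?mulrA.
Qed.

Lemma ideal_mul_scalel x I J : ideal_mul (scale x I) J = scale x (ideal_mul I J).
Proof.
apply/seteqP; split.
  apply: ideal_mul_sub.
  - by exists 0; [exact: ideal_mul0 | rewrite mulr0].
  - by move=> _ _ [u hu <-] [v hv <-]; exists (u + v); [exact: ideal_mulD | rewrite mulrDr].
  - by move=> _ z [y Iy <-] Jz; exists (y * z); [exact: ideal_mul_mem | rewrite mulrA].
move=> _ [z hz <-]; move: z hz.
apply: (ideal_mul_sub (K := [set z | ideal_mul (scale x I) J (x * z)])) => /=.
- by rewrite mulr0; exact: ideal_mul0.
- by move=> u v hu hv; rewrite mulrDr; exact: ideal_mulD.
- by move=> u v Iu Jv; rewrite mulrA; apply: ideal_mul_mem => //; exists u.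
Qed.

Lemma ideal_mul_scale x y I J :
  ideal_mul (scale x I) (scale y J) = scale (x * y) (ideal_mul I J).
Proof.
by rewrite ideal_mul_scalel ideal_mulC ideal_mul_scalel -scaleM ideal_mulC.
Qed.

Lemma fractional_ideal0 d I : fractional_ideal d I -> I 0.
Proof. by case=> _ [x Ix _] _ IM _; have := IM 0 x (Oint0 d) Ix; rewrite mul0r. Qed.

Lemma fractional_ideal_Oint d : fractional_ideal d (Oint d).
Proof.
split; first by move=> x [].
- by exists 1; [exact: Oint1 | exact: oner_neq0].
- by move=> x y; exact: OintD.
- by move=> x y; exact: OintM.
- by exists 1; split; [exact: Oint1 | exact: oner_neq0 | move=> x; rewrite mul1r].
Qed.

Lemma fractional_ideal_mul d I J :
  fractional_ideal d I -> fractional_ideal d J -> fractional_ideal d (ideal_mul I J).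
Proof.
move=> [IQ [x Ix x0] ID IM [a [Oa a0 aI]]] [JQ [y Jy y0] JD JM [b [Ob b0 bJ]]]; split.
- apply: ideal_mul_sub; first exact: (Qsqrt_nat d 0).
    by move=> u v; exact: QsqrtD.
  by move=> u v Iu Jv; apply: QsqrtM; [exact: IQ | exact: JQ].
- by exists (x * y); [exact: ideal_mul_mem | exact: mulf_neq0].
- by move=> u v; exact: ideal_mulD.
- move=> c z Oc; apply: (ideal_mul_sub (K := [set z | ideal_mul I J (c * z)])) => /=.
  + by rewrite mulr0; exact: ideal_mul0.
  + by move=> u v hu hv; rewrite mulrDr; exact: ideal_mulD.
  + by move=> u v Iu Jv; rewrite mulrA; apply: ideal_mul_mem => //; exact: IM.
- exists (a * b); split; [exact: OintM | exact: mulf_neq0 |].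
  apply: (ideal_mul_sub (K := [set z | Oint d (a * b * z)])) => /=.
  + by rewrite mulr0; exact: Oint0.
  + by move=> u v hu hv; rewrite mulrDr; exact: OintD.
  + by move=> u v Iu Jv; rewrite mulrACA; apply: OintM; [exact: aI | exact: bJ].
Qed.

Lemma ideal_mul_Ointl d I : fractional_ideal d I -> ideal_mul (Oint d) I = I.
Proof.
move=> fI; have I0 := fractional_ideal0 fI; have [_ _ ID IM _] := fI.
apply/seteqP; split; first exact: ideal_mul_sub.
by move=> x Ix; rewrite -[x]mul1r; apply: ideal_mul_mem => //; exact: Oint1.
Qed.

Definition ideal_exp d (I : set algC) (n : nat) : set algC := iter n (ideal_mul I) (Oint d).

Lemma fractional_ideal_exp d I n : fractional_ideal d I -> fractional_ideal d (ideal_exp d I n).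
Proof.
by move=> fI; elim: n => [|n IH]; [exact: fractional_ideal_Oint | exact: fractional_ideal_mul].
Qed.

Lemma ideal_expM d I J n :
  ideal_exp d (ideal_mul I J) n = ideal_mul (ideal_exp d I n) (ideal_exp d J n).
Proof.
elim: n => [|n IH] /=; first by rewrite ideal_mul_Ointl //; exact: fractional_ideal_Oint.
by rewrite /ideal_exp /= -!/(ideal_exp d _ n) IH ideal_mulACA.
Qed.

Lemma ideal_exp_scale d x I n : ideal_exp d (scale x I) n = scale (x ^+ n) (ideal_exp d I n).
Proof.
elim: n => [|n IH]; first by rewrite expr0 scale1.
by rewrite /ideal_exp /= -!/(ideal_exp d _ n) IH ideal_mul_scale exprS.
Qed.

Lemma ideal_exp_Oint d n : ideal_exp d (Oint d) n = Oint d.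
Proof.
elim: n => // n IH; rewrite /ideal_exp /= -/(ideal_exp d _ n) IH ideal_mul_Ointl //.
exact: fractional_ideal_Oint.
Qed.

Lemma ideal_exp_mem d I n x : I x -> ideal_exp d I n (x ^+ n).
Proof.
move=> Ix; elim: n => [|n IH]; first exact: Oint1.
by rewrite exprS; exact: ideal_mul_mem.
Qed.

Lemma ideal_equivP d I J :
  ideal_equiv d I J <-> exists x, [/\ Qsqrt d x, x != 0 & J = scale x I].
Proof. by []. Qed.

Lemma ideal_equiv_refl d I : ideal_equiv d I I.
Proof.
by apply/ideal_equivP; exists 1; split; [exact: (Qsqrt_nat d 1) | exact: oner_neq0 | rewrite scale1].
Qed.

Lemma ideal_equiv_sym d I J : (0 < d)%N -> ideal_equiv d I J -> ideal_equiv d J I.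
Proof.
move=> d0 /ideal_equivP[x [Qx x0 ->]]; apply/ideal_equivP; exists x^-1.
by split; [exact: QsqrtV | rewrite invr_eq0 | rewrite -scaleM mulVf // scale1].
Qed.

Lemma ideal_equiv_trans d I J K :
  ideal_equiv d I J -> ideal_equiv d J K -> ideal_equiv d I K.
Proof.
move=> /ideal_equivP[x [Qx x0 ->]] /ideal_equivP[y [Qy y0 ->]]; apply/ideal_equivP.
by exists (y * x); split; [exact: QsqrtM | exact: mulf_neq0 | rewrite scaleM].
Qed.

Lemma ideal_equiv_mul d I J I' J' : ideal_equiv d I I' -> ideal_equiv d J J' ->
  ideal_equiv d (ideal_mul I J) (ideal_mul I' J').
Proof.
move=> /ideal_equivP[x [Qx x0 ->]] /ideal_equivP[y [Qy y0 ->]]; apply/ideal_equivP.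
by exists (x * y); split; [exact: QsqrtM | exact: mulf_neq0 | rewrite ideal_mul_scale].
Qed.

Lemma ideal_equiv_exp d I J n : ideal_equiv d I J ->
  ideal_equiv d (ideal_exp d I n) (ideal_exp d J n).
Proof.
by move=> e; elim: n => [|n IH]; [exact: ideal_equiv_refl | exact: ideal_equiv_mul].
Qed.

Lemma ideal_equiv_scale d x I : Qsqrt d x -> x != 0 -> ideal_equiv d I (scale x I).
Proof. by move=> Qx x0; apply/ideal_equivP; exists x. Qed.

Lemma class_of_eq d I J : (0 < d)%N -> ideal_equiv d I J -> class_of d I = class_of d J.
Proof.
move=> d0 e; apply/seteqP; split=> K [fK eK]; split=> //.
  exact: ideal_equiv_trans (ideal_equiv_sym d0 e) eK.
exact: ideal_equiv_trans e eK.
Qed.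

(** When [class_exp d (class_of d I) g] is the principal class, this membership makes the ideal
    [ideal_exp d I g] principal, the form in which [g]-torsion is used. *)
Lemma class_exp_mem d I n : fractional_ideal d I ->
  class_exp d (class_of d I) n (ideal_exp d I n).
Proof.
move=> fI; elim: n => [|n IH].
  by split; [exact: fractional_ideal_Oint | exact: ideal_equiv_refl].
exists I, (ideal_exp d I n); split=> //.
  by split=> //; exact: ideal_equiv_refl.
split; last exact: ideal_equiv_refl.
by apply: fractional_ideal_mul => //; exact: fractional_ideal_exp.
Qed.

Definition conj_ideal (I : set algC) : set algC := [set z | I (conj z)].

Lemma conj_ideal_mul I J : conj_ideal (ideal_mul I J) = ideal_mul (conj_ideal I) (conj_ideal J).
Proof.
have h (A B : set algC) : conj_ideal (ideal_mul A B) `<=` ideal_mul (conj_ideal A) (conj_ideal B).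
  move=> z; rewrite -[z]conjCK /conj_ideal /= conjCK; move: (conj z).
  apply: (ideal_mul_sub (K := [set z | ideal_mul (conj_ideal A) (conj_ideal B) (conj z)])) => /=.
  - by rewrite rmorph0; exact: ideal_mul0.
  - by move=> u v hu hv; rewrite rmorphD; exact: ideal_mulD.
  - by move=> u v Au Bv; rewrite rmorphM; apply: ideal_mul_mem; rewrite /conj_ideal /= conjCK.
apply/seteqP; split; first exact: h.
have invo A : conj_ideal (conj_ideal A) = A.
  by apply/seteqP; split=> z; rewrite /conj_ideal /= conjCK.
move=> z hz; have := h (conj_ideal I) (conj_ideal J) (conj z); rewrite !invo; apply.
by change (ideal_mul (conj_ideal I) (conj_ideal J) (conj (conj z))); rewrite conjCK.
Qed.

Lemma conj_ideal_Oint d : (0 < d)%N -> conj_ideal (Oint d) = Oint d.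
Proof.
move=> d0; apply/seteqP; split=> z Oz; last exact: Oint_conj.
by rewrite -[z]conjCK; exact: Oint_conj.
Qed.

Lemma conj_ideal_exp d I n : (0 < d)%N ->
  conj_ideal (ideal_exp d I n) = ideal_exp d (conj_ideal I) n.
Proof.
move=> d0; elim: n => [|n IH]; first exact: conj_ideal_Oint.
by rewrite /ideal_exp /= -!/(ideal_exp d _ n) conj_ideal_mul IH.
Qed.

Lemma conj_ideal_scale x I : conj_ideal (scale x I) = scale (conj x) (conj_ideal I).
Proof.
apply/seteqP; split=> z.
  move=> [y Iy e]; exists (conj y); first by rewrite /conj_ideal /= conjCK.
  by rewrite -rmorphM e /= conjCK.
by move=> [y Iy <-]; exists (conj y) => //; rewrite rmorphM /= conjCK.
Qed.

(** * Split prime ideals *)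

(** Replacing [m] by [- m] gives the conjugate ideal and, at a split root, an ideal in the inverse
    class, by [prime_ideal_mul]. *)
Definition prime_ideal d (p : nat) (m : int) : set algC :=
  [set z | exists x y, [/\ Oint d x, Oint d y & z = p%:R * x + ('s_d - m%:~R) * y]].

(** The second clause says that [p] is prime to [2 * m], as a Bezout identity that can be multiplied
    out directly in the ring of integers. *)
Definition split_root (d p : nat) (m : int) : Prop :=
  (exists k : int, m ^+ 2 + d%:Z = p%:Z * k) /\ (exists a b : int, a * p%:Z + b * (2 * m) = 1).

Lemma split_rootN d p m : split_root d p m -> split_root d p (- m).
Proof.
move=> [[k hk] [a [b hab]]]; split; first by exists k; rewrite sqrrN.
by exists a, (- b); rewrite mulrN mulrNN.
Qed.

Lemma Oint_sqrtN_sub d (m : int) : Oint d ('s_d - m%:~R).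
Proof. by apply: OintB; [exact: Oint_sqrtCN | exact: Oint_int]. Qed.

Lemma prime_ideal_sub d p m : prime_ideal d p m `<=` Oint d.
Proof.
move=> _ [x [y [Ox Oy ->]]]; apply: OintD; apply: OintM => //.
  exact: Oint_nat.
exact: Oint_sqrtN_sub.
Qed.

Lemma prime_ideal_nat d p m : prime_ideal d p m p%:R.
Proof. by exists 1, 0; split; [exact: Oint1 | exact: Oint0 | rewrite mulr1 mulr0 addr0]. Qed.

Lemma prime_ideal_gen d p m : prime_ideal d p m ('s_d - m%:~R).
Proof. by exists 0, 1; split; [exact: Oint0 | exact: Oint1 | rewrite mulr1 mulr0 add0r]. Qed.

Lemma fractional_prime_ideal d p m : (0 < p)%N -> fractional_ideal d (prime_ideal d p m).
Proof.
move=> p0; split.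
- by move=> z /prime_ideal_sub[].
- by exists p%:R; [exact: prime_ideal_nat | rewrite pnatr_eq0 -lt0n].
- move=> _ _ [x [y [Ox Oy ->]]] [x' [y' [Ox' Oy' ->]]].
  by exists (x + x'), (y + y'); split; [exact: OintD | exact: OintD | ring].
- move=> a _ Oa [x [y [Ox Oy ->]]].
  by exists (a * x), (a * y); split; [exact: OintM | exact: OintM | ring].
- by exists 1; split; [exact: Oint1 | exact: oner_neq0 | move=> x /prime_ideal_sub; rewrite mul1r].
Qed.

Lemma intr_split (R : pzRingType) (m : int) (d p : nat) (k : int) :
  m ^+ 2 + d%:Z = p%:Z * k -> m%:~R ^+ 2 + d%:R = p%:R * k%:~R :> R.
Proof. by move/(congr1 (fun z : int => z%:~R : R)); rewrite rmorphD rmorphXn rmorphM. Qed.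

Lemma intr_bezout (R : pzRingType) (a b c : int) (p : nat) :
  a * p%:Z + b * c = 1 -> a%:~R * p%:R + b%:~R * c%:~R = 1 :> R.
Proof. by move/(congr1 (fun z : int => z%:~R : R)); rewrite rmorphD !rmorphM. Qed.

Lemma prime_ideal_mul d p m : split_root d p m ->
  ideal_mul (prime_ideal d p m) (prime_ideal d p (- m)) = scale p%:R (Oint d).
Proof.
move=> [[k hk] [a [b hab]]]; have hkC := intr_split algC hk.
have hs := sqrtCN_sqr d.
apply/seteqP; split.
  apply: ideal_mul_sub.
  - by exists 0; [exact: Oint0 | rewrite mulr0].
  - by move=> _ _ [u hu <-] [v hv <-]; exists (u + v); [exact: OintD | rewrite mulrDr].
  - move=> _ _ [x [y [Ox Oy ->]]] [x' [y' [Ox' Oy' ->]]].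
    exists (x * (p%:R * x' + ('s_d - (- m)%:~R) * y') + ('s_d - m%:~R) * y * x' - k%:~R * y * y').
      apply: OintB; last by apply: OintM => //; apply: OintM => //; exact: Oint_int.
      apply: OintD; last by apply: OintM => //; apply: OintM => //; exact: Oint_sqrtN_sub.
      by apply: OintM => //; apply: (@prime_ideal_sub d p (- m)); exists x', y'.
    rewrite rmorphN opprK; move: hs hkC; set s := 's_d => hs hkC.
    have e : (s - m%:~R) * (s + m%:~R) = - (p%:R * k%:~R).
      by rewrite -hkC opprD [in RHS]addrC -hs; ring.
    transitivity (p%:R * (x * (p%:R * x' + (s + m%:~R) * y') + (s - m%:~R) * y * x') - (p%:R * k%:~R) * y * y'); first by ring.
    by rewrite -[p%:R * k%:~R]opprK -e; ring.
move=> _ [z Oz <-].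
(* The Bezout identity is applied to [p * p] and to [p * (s + m) - (s - m) * p = 2 * m * p], with
   [s = 's_d]; both lie in the product. *)
have -> : p%:R * z = (a%:~R * z * p%:R) * p%:R + ((b%:~R * z * p%:R) * ('s_d - (- m)%:~R)
   + (- (b%:~R * z) * ('s_d - m%:~R)) * p%:R).
  have h := intr_bezout algC hab; rewrite intrM in h.
  transitivity (p%:R * z * (a%:~R * p%:R + b%:~R * (2 * m%:~R))); first by rewrite h mulr1.
  by rewrite rmorphN opprK; ring.
have p_mem := prime_ideal_nat d p; have g_mem := prime_ideal_gen d p.
have M c x n : Oint d c -> prime_ideal d p n x -> prime_ideal d p n (c * x).
  move=> Oc [u [v [Ou Ov ->]]].
  by exists (c * u), (c * v); split; [exact: OintM | exact: OintM | ring].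
have Oaz : Oint d (a%:~R * z) by apply: OintM => //; exact: Oint_int.
have Obz : Oint d (b%:~R * z) by apply: OintM => //; exact: Oint_int.
apply: ideal_mulD; [|apply: ideal_mulD]; apply: ideal_mul_mem; try exact: M; try exact: p_mem.
- exact: g_mem.
- by apply: M; [exact: OintN | exact: g_mem].
Qed.

Lemma conj_prime_ideal d p m : (0 < d)%N ->
  conj_ideal (prime_ideal d p m) = prime_ideal d p (- m).
Proof.
move=> d0.
have h n : conj_ideal (prime_ideal d p n) `<=` prime_ideal d p (- n).
  move=> z [x [y [Ox Oy e]]]; exists (conj x), (- conj y); split.
  - exact: Oint_conj.
  - by apply: OintN; exact: Oint_conj.
  - rewrite -[z]conjCK e rmorphD !rmorphM rmorphB /= conj_sqrtCN // rmorph_nat !rmorph_int.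
    by rewrite rmorphN; ring.
apply/seteqP; split; first exact: h.
move=> z hz; rewrite /conj_ideal /= -[m]opprK; apply: h.
by rewrite /conj_ideal /= conjCK.
Qed.

Lemma scale_Oint_mem d x : scale x (Oint d) x.
Proof. by exists 1; [exact: Oint1 | rewrite mulr1]. Qed.

(** The two generators are positive rationals whose quotients, in either direction, are rational and
    integral, hence positive integers with product 1. *)
Lemma mul_conj_eq_nat d (n : nat) (alpha : algC) : (0 < d)%N -> (0 < n)%N -> Oint d alpha ->
  scale (alpha * conj alpha) (Oint d) = scale n%:R (Oint d) -> alpha * conj alpha = n%:R.
Proof.
move=> d0 n0 [/QsqrtP[a [b ->]] _]; rewrite mul_conj_quad //.
set q := a ^+ 2 + _; have q0 : 0 <= q.
  by apply: addr_ge0; [exact: sqr_ge0 | apply: mulr_ge0 => //; exact: sqr_ge0].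
have nC : n%:R != 0 :> algC by rewrite pnatr_eq0 -lt0n.
have nQ : 0 < n%:R :> rat by rewrite ltr0n.
move=> e; have [x Ox ex] : scale n%:R (Oint d) (ratr q) by rewrite -e; exact: scale_Oint_mem.
have [y Oy ey] : scale (ratr q) (Oint d) n%:R by rewrite e; exact: scale_Oint_mem.
have qC : (ratr q : algC) != 0.
  by apply/negP => /eqP q0'; move: ey nC; rewrite q0' mul0r => <-; rewrite eqxx.
have qn0 : q != 0 by move: qC; rewrite fmorph_eq0.
have /intrP[i ei] : q / n%:R \is a Num.int.
  by apply: (@Oint_rat d); rewrite fmorph_div rmorph_nat /= -ex mulrAC mulfV // mul1r.
have /intrP[j ej] : n%:R / q \is a Num.int.
  by apply: (@Oint_rat d); rewrite fmorph_div rmorph_nat /= -ey mulrAC mulfV // mul1r.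
have q1 : 0 < q by rewrite lt_neqAle eq_sym qn0.
have i0 : 0 < i by rewrite -(ltr0z rat) -ei divr_gt0.
have j0 : 0 < j by rewrite -(ltr0z rat) -ej divr_gt0.
have ij : i * j = 1.
  by apply: (@intr_inj rat); rewrite intrM -ei -ej mulrA divfK ?divff // gt_eqF.
have i1 : i = 1 by nia.
have -> : q = n%:R by move: ei; rewrite i1 => /(canRL (divfK (lt0r_neq0 nQ))); rewrite mul1r.
by rewrite rmorph_nat.
Qed.

(** Modulo ['s_d + m], the number ['s_d - m] is the integer [- 2 * m]. *)
Lemma sqrtN_sub_exp d (m : int) n : exists2 w, Oint d w &
  ('s_d - m%:~R) ^+ n = ('s_d + m%:~R) * w + ((- (2 * m)) ^+ n)%:~R.
Proof.
elim: n => [|n [w Ow IH]]; first by exists 0; [exact: Oint0 | rewrite mulr0 add0r !expr0].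
exists (('s_d - m%:~R) * w + ((- (2 * m)) ^+ n)%:~R).
  apply: OintD; last exact: Oint_int.
  by apply: OintM => //; exact: Oint_sqrtN_sub.
rewrite exprS IH [in RHS]exprS intrM rmorphN rmorphM /=.
move: ((_ ^+ n)%:~R) => c; ring.
Qed.

Lemma Bezout_coprimez (p : nat) (c : int) : coprime p `|c| ->
  exists a b : int, a * p%:Z + b * c = 1.
Proof.
move=> co; have [u [v e]] := Bezoutz p%:Z c.
exists u, v; rewrite e /gcdz absz_nat; congr (Posz _); exact/eqP.
Qed.

(** Write [s] for ['s_d]. If [p] divided [u] and [v], then [2 * n * (s - m) ^ g] would lie in [p O].
    Modulo [s + m] it is the integer [2 * n * (- 2 * m) ^ g], prime to [p], so 1 would lie in
    [p O + (s + m) O]. Multiplying by [s - m] puts [s - m] in [p O], although [p] does not divide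
    its trace [- 2 * m]. *)
Lemma not_dvd_coord d p (m n : int) (u v : int) alpha g : (0 < d)%N -> prime p -> (2 < p)%N ->
  split_root d p m -> coprime p `|n| -> 2 * alpha = u%:~R + v%:~R * 's_d ->
  (p%:Z %| u)%Z -> (p%:Z %| v)%Z ->
  ~ scale alpha (Oint d) (n%:~R * ('s_d - m%:~R) ^+ g).
Proof.
move=> d0 pp p2 [[k hk] [a [b hab]]] cop e2 /dvdzP[u' eu] /dvdzP[v' ev] [y Oy ey].
have hkC := intr_split algC hk; have hs := sqrtCN_sqr d.
have [w Ow ew] := sqrtN_sub_exp d m g.
have pC : p%:R != 0 :> algC by rewrite pnatr_eq0 -lt0n prime_gt0.
have co2m : coprime p `|2 * m|.
  rewrite prime_coprime //; apply/negP => /dvdnP[q eq].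
  have : a * p%:Z + b * (2 * m) \in dvdz p%:Z.
    apply: rpredD; first exact: dvdz_mull.
    by apply: dvdz_mull; rewrite dvdzE eq dvdn_mull.
  by rewrite hab dvdzE absz_nat dvdn1 => /eqP p1; move: p2; rewrite p1.
have coc : coprime p `|2 * n * (- (2 * m)) ^+ g|.
  have : coprime p (2 * `|n| * `|(2 * m)%R| ^ g)%N.
    rewrite !coprimeMr cop coprimeXr // andbT.
    by rewrite prime_coprime // gtnNdvd.
  by move=> h; rewrite abszM abszX abszN (abszM 2 n).
have [a' [b' hab']] := Bezout_coprimez coc.
pose y' : algC := (u'%:~R + v'%:~R * 's_d) * y.
have Oy' : Oint d y'.
  apply: OintM => //; apply: OintD; first exact: Oint_int.
  by apply: OintM; [exact: Oint_int | exact: Oint_sqrtCN].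
have ey' : 2 * (n%:~R * ('s_d - m%:~R) ^+ g) = p%:R * y'.
  by rewrite -ey mulrA e2 eu ev !intrM /y' -[(Posz p)%:~R]/(p%:R); ring.
have one : 1 = p%:R * (a'%:~R + b'%:~R * y') - ('s_d + m%:~R) * (b'%:~R * (2 * n%:~R * w)).
  transitivity (a'%:~R * p%:R + b'%:~R * (2 * n%:~R * ((- (2 * m)) ^+ g)%:~R) : algC).
    by have h := intr_bezout algC hab'; rewrite !intrM in h; exact: (esym h).
  have -> : ((- (2 * m)) ^+ g)%:~R = ('s_d - m%:~R) ^+ g - ('s_d + m%:~R) * w.
    by rewrite ew addrAC subrr add0r.
  rewrite mulrBr mulrBr -mulrA ey'; ring.
pose t := (a'%:~R + b'%:~R * y') * ('s_d - m%:~R) + k%:~R * (b'%:~R * (2 * n%:~R * w)).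
have Ot : Oint d t.
  apply: OintD; apply: OintM.
  - by apply: OintD; [|apply: OintM => //]; exact: Oint_int.
  - exact: Oint_sqrtN_sub.
  - exact: Oint_int.
  - by do 3![apply: OintM => //; try exact: Oint_int]; exact: (Oint_nat d 2).
have et : 's_d - m%:~R = p%:R * t.
  have e : ('s_d - m%:~R) * ('s_d + m%:~R) = - (p%:R * k%:~R).
    by rewrite -hkC opprD [in RHS]addrC -hs; ring.
  move: one; rewrite /t; set W := b'%:~R * (2 * n%:~R * w) => one.
  transitivity (('s_d - m%:~R) * (p%:R * (a'%:~R + b'%:~R * y') - ('s_d + m%:~R) * W)).
    by rewrite -one mulr1.
  rewrite mulrBr [('s_d - _) * (('s_d + _) * _)]mulrA e; ring.
have tE : t = ratr (- m%:~R / p%:R) + ratr (p%:R^-1) * 's_d.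
  rewrite fmorph_div rmorphN fmorphV rmorph_nat rmorph_int /=.
  by apply: (mulfI pC); rewrite -et; field.
have [] := Oint_quad d0 (eq_ind _ (Oint d) Ot _ tE).
move=> /intrP[q eq] _.
have : (p%:Z %| 2 * m)%Z.
  apply/dvdzP; exists (- q); apply: (@intr_inj rat).
  rewrite !intrM rmorphN /= -eq.
  have pQ : p%:R != 0 :> rat by rewrite pnatr_eq0 -lt0n prime_gt0.
  by rewrite -[(Posz p)%:~R]/(p%:R); field.
by rewrite dvdzE absz_nat => h; move: co2m; rewrite prime_coprime // h.
Qed.

(** Raising the collision to the power [g] kills [I] and [I'], so [P ^ g] and [P' ^ g] are
    equivalent; multiplying by the conjugate of [P' ^ g] turns the latter into the principal ideal
    of [p' ^ g]. *)
Lemma collision_principal d g I I' p p' m m' : (0 < d)%N -> (0 < p)%N -> (0 < p')%N ->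
  ideal_equiv d (Oint d) (ideal_exp d I g) -> ideal_equiv d (Oint d) (ideal_exp d I' g) ->
  split_root d p' m' ->
  ideal_equiv d (ideal_mul I (prime_ideal d p m)) (ideal_mul I' (prime_ideal d p' m')) ->
  exists alpha, ideal_mul (ideal_exp d (prime_ideal d p m) g)
    (ideal_exp d (prime_ideal d p' (- m')) g) = scale alpha (Oint d).
Proof.
move=> d0 p0 p'0 eI eI' sr e.
set P := prime_ideal d p m in e *; set P' := prime_ideal d p' m' in e.
set P'' := prime_ideal d p' (- m').
have fP : fractional_ideal d (ideal_exp d P g).
  by apply: fractional_ideal_exp; apply: fractional_prime_ideal.
have fP' : fractional_ideal d (ideal_exp d P' g).
  by apply: fractional_ideal_exp; apply: fractional_prime_ideal.
have h A B : ideal_equiv d (Oint d) (ideal_exp d A g) -> fractional_ideal d (ideal_exp d B g) ->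
    ideal_equiv d (ideal_exp d B g) (ideal_exp d (ideal_mul A B) g).
  move=> eA fB; rewrite ideal_expM -{1}(ideal_mul_Ointl fB).
  by apply: ideal_equiv_mul => //; exact: ideal_equiv_refl.
have e1 : ideal_equiv d (ideal_exp d P g) (ideal_exp d P' g).
  apply: ideal_equiv_trans (h _ _ eI fP) _.
  apply: ideal_equiv_trans (ideal_equiv_exp g e) _.
  exact: (ideal_equiv_sym d0 (h _ _ eI' fP')).
have e2 : ideal_equiv d (Oint d) (ideal_mul (ideal_exp d P g) (ideal_exp d P'' g)).
  apply: (ideal_equiv_sym d0).
  apply: ideal_equiv_trans (ideal_equiv_mul e1 (ideal_equiv_refl d (ideal_exp d P'' g))) _.
  rewrite -ideal_expM prime_ideal_mul // ideal_exp_scale ideal_exp_Oint.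
  apply: (ideal_equiv_sym d0); apply: ideal_equiv_scale.
    by rewrite -natrX; exact: Qsqrt_nat.
  by rewrite expf_neq0 // pnatr_eq0 -lt0n.
by have /ideal_equivP[alpha [_ _ ->]] := e2; exists alpha.
Qed.

Lemma ideal_mul_sub_Oint d I J : I `<=` Oint d -> J `<=` Oint d -> ideal_mul I J `<=` Oint d.
Proof.
move=> hI hJ; apply: ideal_mul_sub; first exact: Oint0.
  by move=> x y; exact: OintD.
by move=> x y /hI Ix /hJ Jy; exact: OintM.
Qed.

Lemma ideal_exp_sub_Oint d I n : I `<=` Oint d -> ideal_exp d I n `<=` Oint d.
Proof. by move=> hI; elim: n => [//|n IH]; exact: ideal_mul_sub_Oint. Qed.

(** The ideal times its conjugate is generated by [(p * p') ^ g], by [prime_ideal_mul];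
    [mul_conj_eq_nat] turns this equality of ideals into one of numbers. *)
Lemma generator_norm d g p p' m m' alpha : (0 < d)%N -> (0 < p)%N -> (0 < p')%N ->
  split_root d p m -> split_root d p' m' ->
  ideal_mul (ideal_exp d (prime_ideal d p m) g)
    (ideal_exp d (prime_ideal d p' (- m')) g) = scale alpha (Oint d) ->
  Oint d alpha /\ alpha * conj alpha = ((p * p') ^ g)%:R.
Proof.
move=> d0 p0 p'0 sr sr' e.
have Oa : Oint d alpha.
  have : scale alpha (Oint d) alpha by exact: scale_Oint_mem.
  by rewrite -e; apply: ideal_mul_sub_Oint; apply: ideal_exp_sub_Oint; exact: prime_ideal_sub.
split=> //; apply: (mul_conj_eq_nat d0) => //; first by rewrite expn_gt0 muln_gt0 p0 p'0.
have ec : scale (conj alpha) (Oint d) =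
    ideal_mul (ideal_exp d (prime_ideal d p (- m)) g) (ideal_exp d (prime_ideal d p' m') g).
  rewrite -{1}(conj_ideal_Oint d0) -conj_ideal_scale -e conj_ideal_mul.
  by rewrite !conj_ideal_exp // !conj_prime_ideal // opprK.
have sM x y : ideal_mul (scale x (Oint d)) (scale y (Oint d)) = scale (x * y) (Oint d).
  by rewrite ideal_mul_scale (ideal_mul_Ointl (fractional_ideal_Oint d)).
rewrite -sM ec -e ideal_mulACA -!ideal_expM prime_ideal_mul //.
rewrite (ideal_mulC (prime_ideal d p' _)) prime_ideal_mul //.
by rewrite sM ideal_exp_scale ideal_exp_Oint -natrM -natrX.
Qed.

(** If [v] is even, so is [u], and 4 cancels; if [v] is odd, 2 is no common factor. Hence the two
    possible values. Any other common prime divides [p * p'], so it is [p] or [p'], and these do not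
    divide [v]. *)
Lemma primitively_repr_of_norm d g p p' (u v : nat) : (0 < d)%N -> prime p -> prime p' ->
  (u ^ 2 + d * v ^ 2 = 4 * (p * p') ^ g)%N -> ~~ (p %| v)%N -> ~~ (p' %| v)%N ->
  primitively_repr (4 * (p * p') ^ g) d || primitively_repr ((p * p') ^ g) d.
Proof.
move=> d0 pp pp' e pv p'v.
have v0 : (0 < v)%N by case: v pv {e p'v}; rewrite ?dvdn0.
have key q : prime q -> (q %| v)%N -> ~~ (q %| (p * p') ^ g)%N.
  move=> pq qv; apply/negP; rewrite Euclid_dvdX // Euclid_dvdM // => /andP[/orP[]].
    by rewrite dvdn_prime2 // => /eqP eqp; move: pv; rewrite -eqp qv.
  by rewrite dvdn_prime2 // => /eqP eqp; move: p'v; rewrite -eqp qv.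
have cop t w : (0 < w)%N -> (forall q, prime q -> q %| t -> q %| w -> False)%N -> coprime t w.
  move=> w0 h; apply/eqP; apply/eqP; have [//|g1] := eqVneq (gcdn t w) 1%N.
  have g0 : (0 < gcdn t w)%N by rewrite gcdn_gt0 w0 orbT.
  case: (h (pdiv (gcdn t w))).
  - by apply: pdiv_prime; case: (gcdn t w) g0 g1 => [|[]].
  - exact: dvdn_trans (pdiv_dvd _) (dvdn_gcdl _ _).
  - exact: dvdn_trans (pdiv_dvd _) (dvdn_gcdr _ _).
have [v_even|v_odd] := boolP (2 %| v)%N.
  have u_even : (2 %| u)%N.
    have : (2 %| u ^ 2)%N.
      rewrite -(@dvdn_addl (d * v ^ 2)); first by rewrite e dvdn_mulr.
      by rewrite dvdn_mull // -mulnn dvdn_mulr.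
    by rewrite Euclid_dvdX // => /andP[].
  have /dvdnP[w ew] := v_even; have /dvdnP[t et] := u_even.
  apply/orP; right.
  have w0 : (0 < w)%N by move: v0; rewrite ew muln_gt0 => /andP[].
  have e' : (t ^ 2 + d * w ^ 2 = (p * p') ^ g)%N.
    apply/eqP; rewrite -(eqn_pmul2l (isT : 0 < 4)%N) -e ew et !expnMn; apply/eqP.
    by clear; lia.
  apply: (@primitively_reprI _ _ t w) => //; apply: cop => // q pq qt qw.
  have := key q pq; rewrite ew dvdn_mulr // => /(_ isT) /negP; apply.
  by rewrite -e'; apply: dvdn_add; [|apply: dvdn_mull]; apply: dvdn_exp.
apply/orP; left.
apply: (@primitively_reprI _ _ u v) => //; apply: cop => // q pq qu qv.
have := key q pq qv => /negP; apply.
have : (q %| 4 * (p * p') ^ g)%N.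
  by rewrite -e; apply: dvdn_add; [|apply: dvdn_mull]; apply: dvdn_exp.
rewrite Euclid_dvdM // => /orP[|//].
rewrite (Euclid_dvdM 2 2 pq) orbb dvdn_prime2 // => /eqP q2.
by move: v_odd; rewrite -q2 qv.
Qed.

Lemma collision_repr d g I I' p p' m m' : (0 < d)%N -> (0 < g)%N -> squarefree d ->
  prime p -> prime p' -> (2 < p)%N -> (2 < p')%N -> p != p' ->
  ideal_equiv d (Oint d) (ideal_exp d I g) -> ideal_equiv d (Oint d) (ideal_exp d I' g) ->
  split_root d p m -> split_root d p' m' ->
  ideal_equiv d (ideal_mul I (prime_ideal d p m)) (ideal_mul I' (prime_ideal d p' m')) ->
  primitively_repr (4 * (p * p') ^ g) d || primitively_repr ((p * p') ^ g) d.
Proof.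
move=> d0 g0 sq pp pp' p2 p2' neq eI eI' sr sr' e.
have p0 := prime_gt0 pp; have p'0 := prime_gt0 pp'.
have [alpha ea] := collision_principal d0 p0 p'0 eI eI' sr' e.
have [Oa na] := generator_norm d0 p0 p'0 sr sr' ea.
have [u [v e2]] := Oint_half d0 sq Oa.
have nuv : (`|u| ^ 2 + d * `|v| ^ 2 = 4 * (p * p') ^ g)%N.
  have : u ^+ 2 + d%:Z * v ^+ 2 = (4 * (p * p') ^ g)%N%:Z.
    apply: (@intr_inj algC); rewrite -[(Posz (_ * _)%N)%:~R]/((4 * (p * p') ^ g)%:R) natrM -na.
    have -> : 4%:R * (alpha * conj alpha) = (2 * alpha) * conj (2 * alpha).
      by rewrite rmorphM rmorph_nat; ring.
    rewrite e2 -[u%:~R]ratr_int -[v%:~R]ratr_int mul_conj_quad //.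
    by rewrite !(rmorphD, rmorphM, rmorphXn, rmorph_nat) /= !ratr_int.
  have sqE (z : int) : (`|z| ^ 2)%N%:Z = z ^+ 2 by rewrite -abszX gez0_abs ?sqr_ge0.
  by move=> h; apply/eqP; rewrite -eqz_nat -h PoszD PoszM !sqE.
have dvd_u q : prime q -> (q %| (p * p') ^ g)%N -> (q %| `|v|)%N -> (q %| `|u|)%N.
  move=> pq qpp qv; have : (q %| `|u| ^ 2)%N.
    rewrite -(@dvdn_addl (d * `|v| ^ 2)); first by rewrite nuv dvdn_mull.
    by rewrite dvdn_mull // -mulnn dvdn_mulr.
  by rewrite Euclid_dvdX // => /andP[].
have mem (a b : algC) : prime_ideal d p m a -> prime_ideal d p' (- m') b ->
    scale alpha (Oint d) (a ^+ g * b ^+ g).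
  by move=> ha hb; rewrite -ea; apply: ideal_mul_mem; exact: ideal_exp_mem.
have copX q q' : prime q -> prime q' -> q != q' -> coprime q `|(q'%:Z ^+ g)%R|.
  by move=> pq pq' n; rewrite abszX absz_nat coprimeXr // prime_coprime // dvdn_prime2.
(* If [p] divides [v], it divides [u] too, and the element [p' ^ g * ('s_d - m) ^ g] of the ideal
   contradicts [not_dvd_coord], as [p'] is prime to [p]. For [p'] the element is
   [p ^ g * ('s_d + m') ^ g]. *)
apply: (primitively_repr_of_norm d0 pp pp' nuv); apply/negP => h.
  have hu : (p %| `|u|)%N by apply: dvd_u => //; rewrite Euclid_dvdX // g0 andbT dvdn_mulr.
  apply: (not_dvd_coord (g := g) d0 pp p2 sr (copX _ _ pp pp' neq) e2); rewrite ?dvdzE //.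
  by rewrite rmorphXn /= mulrC; apply: mem; [exact: prime_ideal_gen | exact: prime_ideal_nat].
have hu : (p' %| `|u|)%N by apply: dvd_u => //; rewrite Euclid_dvdX // g0 andbT dvdn_mull.
have neq' : p' != p by rewrite eq_sym.
apply: (not_dvd_coord (g := g) d0 pp' p2' (split_rootN sr') (copX _ _ pp' pp neq') e2); rewrite ?dvdzE //.
by rewrite rmorphXn /=; apply: mem; [exact: prime_ideal_nat | exact: prime_ideal_gen].
Qed.

(** * Reduction and counting of classes *)

Definition lattice d (a m : nat) : set algC :=
  [set z | exists x y : int, z = x%:~R + y%:~R * (('s_d - m%:R) / a%:R)].

Lemma Oint_norm_nat d x : (0 < d)%N -> Oint d x -> exists n : nat, x * conj x = n%:R.
Proof.
move=> d0 Ox; have [/QsqrtP[a [b ex]] _] := Ox; rewrite ex in Ox *.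
have [_ /intrP[k ek]] := Oint_quad d0 Ox.
have k0 : 0 <= k.
  rewrite -(ler0z rat) -ek; apply: addr_ge0; first exact: sqr_ge0.
  by apply: mulr_ge0 => //; exact: sqr_ge0.
by exists `|k|%N; rewrite mul_conj_quad // ek ratr_int -{1}(gez0_abs k0).
Qed.

(* [x0] is a nonzero element of [I] of minimal norm. *)
Lemma minimal_scaling d I : (0 < d)%N -> fractional_ideal d I ->
  exists (x0 : algC) (n : nat), [/\ Qsqrt d x0, x0 != 0, I x0, (0 < n)%N &
    (forall z, I (x0 * z) -> Oint d (n%:R * z)) /\
    (forall z, I (x0 * z) -> z != 0 -> 1 <= z * conj z)].
Proof.
move=> d0 [IQ [x Ix xn0] ID IM [c [Oc cn0 cI]]].
(* Multiplying by the common denominator [c] makes the norms natural numbers, so a minimal one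
   exists. *)
pose P n := `[< exists y, [/\ I y, y != 0 & (c * y) * conj (c * y) = n%:R] >].
have exP : exists n, P n.
  have [n en] := Oint_norm_nat d0 (cI x Ix).
  by exists n; apply/asboolP; exists x.
have [n /asboolP[x0 [Ix0 x0n0 en]] min] := ex_minnP exP.
have cx0 : c * x0 != 0 by rewrite mulf_neq0.
have n0 : (0 < n)%N.
  by rewrite lt0n -(@pnatr_eq0 algC) -en mulf_neq0 // fmorph_eq0.
exists x0, n; split=> //; first exact: IQ.
split=> z Iz.
  rewrite -en mulrAC mulrC -[c * x0 * z]mulrA; apply: OintM; last exact: cI.
  by apply: Oint_conj => //; exact: cI.
move=> zn0; have [n' en'] := Oint_norm_nat d0 (cI _ Iz).
have le : (n <= n')%N by apply: min; apply/asboolP; exists (x0 * z); split=> //; rewrite mulf_neq0.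
have -> : z * conj z = n'%:R / n%:R.
  have nC : n%:R != 0 :> algC by rewrite pnatr_eq0 -lt0n.
  apply: (mulfI nC); rewrite [RHS]mulrC divfK // -en' -en !rmorphM /=; ring.
by rewrite ler_pdivlMr ?ltr0n // mul1r ler_nat.
Qed.

(** Gauss reduction on lattices: [J] is [I] divided by an element of minimal norm, so 1 is shortest
    in [J]. A second basis vector is one with the least positive coordinate along ['s_d]. *)
Lemma reduction d I : (0 < d)%N -> squarefree d -> fractional_ideal d I ->
  exists a m : nat, [/\ (m < a)%N, (3 * a ^ 2 <= 4 * d)%N, (a %| m ^ 2 + d)%N &
    ideal_equiv d I (lattice d a m)].
Proof.
move=> d0 sq fI; have [x0 [n [Qx0 x0n0 Ix0 n0 [den min]]]] := minimal_scaling d0 fI.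
have [IQ _ ID IM _] := fI.
pose J := [set z | I (x0 * z)].
have JD z w : J z -> J w -> J (z + w) by rewrite /J /= mulrDr; exact: ID.
have JM a z : Oint d a -> J z -> J (a * z) by rewrite /J /= mulrCA; exact: IM.
have J1 : J 1 by rewrite /J /= mulr1.
have JO a : Oint d a -> J a by move=> Oa; rewrite -[a]mulr1; exact: JM.
have nC : n%:R != 0 :> algC by rewrite pnatr_eq0 -lt0n.
have s0 := sqrtCN_neq0 d0.
have minq (a b : rat) : J (ratr a + ratr b * 's_d) -> (a != 0) || (b != 0) ->
    1 <= a ^+ 2 + d%:R * b ^+ 2.
  move=> Jz ab; rewrite -(ler_rat algC) rmorph1 -mul_conj_quad //; apply: min => //.
  apply/eqP => z0; have [|ea eb] := @quad_inj d a b 0 0 d0; first by rewrite z0 rmorph0 mul0r addr0.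
  by move: ab; rewrite ea eb eqxx.
(* Otherwise, subtracting the nearest integer would leave a nonzero element of norm at most 1/4. *)
have Jrat (y : rat) : J (ratr y) -> exists i : int, y = i%:~R.
  move=> Jy; exists (Num.floor (y + 2^-1)); set f := Num.floor _.
  have /andP[f1 f2] := Num.Theory.floor_itv (y + 2^-1); rewrite -/f in f1 f2.
  apply/eqP; rewrite -subr_eq0; apply/negPn/negP => e0.
  have : 1 <= (y - f%:~R) ^+ 2 + d%:R * 0 ^+ 2.
    apply: minq; last by rewrite e0.
    rewrite rmorph0 mul0r addr0 rmorphB /= ratr_int; apply: JD => //.
    by apply: JO; apply: OintN; exact: Oint_int.
  by move: f2; rewrite intrD; nra.
(* For [z] in [J], [n * z] is integral, so [2 * n * z] has integer coordinates and a least positive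
   one exists. *)
pose V k := (0 < k)%N && `[< exists z (u : int), J z /\ 2 * n%:R * z = u%:~R + k%:R * 's_d >].
have exV : exists k, V k.
  exists (2 * n)%N; rewrite /V muln_gt0 n0; apply/asboolP; exists 's_d, 0.
  by split; [apply: JO; exact: Oint_sqrtCN | rewrite natrM add0r].
have [k /andP[k0 /asboolP[tau [u0 [Jtau etau]]]] kmin] := ex_minnP exV.
have n2C : 2 * n%:R != 0 :> algC by rewrite mulf_neq0 // pnatr_eq0.
have Jgen z : J z -> exists x q : int, z = x%:~R + q%:~R * tau.
  move=> Jz; have [u [v ez]] := Oint_half d0 sq (den _ Jz); rewrite mulrA in ez.
  pose q := (v %/ k%:Z)%Z; pose r := (v %% k%:Z)%Z.
  have ev : v = q * k%:Z + r by exact: divz_eq.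
  have r_ge0 : 0 <= r by rewrite modz_ge0 // -lt0n.
  have r_lt : r < k%:Z by rewrite ltz_pmod // ltz_nat.
  clearbody q r.
  have Jw : J (z - q%:~R * tau).
    by apply: JD => //; rewrite -mulNr; apply: JM => //; apply: OintN; exact: Oint_int.
  have ew : 2 * n%:R * (z - q%:~R * tau) = (u - q * u0)%:~R + r%:~R * 's_d.
    rewrite mulrBr ez mulrCA etau ev rmorphB !intrD !intrM -[(Posz k)%:~R]/(k%:R).
    by ring.
  have r0 : r = 0.
    case er : r r_ge0 => [[|r']|//] _ //; exfalso.
    have := kmin r'.+1; rewrite leqNgt -ltz_nat -er r_lt => W.
    suff : V r'.+1 by move/W.
    apply/andP; split=> //; apply/asboolP; exists (z - q%:~R * tau), (u - q * u0).
    by split=> //; rewrite ew er.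
  have er : z - q%:~R * tau = ratr ((u - q * u0)%:~R / (2 * n%:R)).
    rewrite fmorph_div rmorphM !rmorph_nat /= ratr_int.
    by apply: (mulfI n2C); rewrite ew r0 mul0r addr0 [RHS]mulrC divfK.
  have [i ei] := Jrat _ (eq_ind _ J Jw _ er).
  by exists i, q; rewrite -[LHS](subrK (q%:~R * tau)) er ei ratr_int.
(* Writing ['s_d] in the basis yields [a], positive because [a * k = 2 * n]; [m] is then [x] reduced
   modulo [a]. *)
have [x [a es]] := Jgen _ (JO _ (Oint_sqrtCN d)).
have ak : (2 * n)%:R = a%:~R * k%:R :> rat.
  have [|//] := @quad_inj d 0 (2 * n)%:R (2 * n%:R * x%:~R + a%:~R * u0%:~R) (a%:~R * k%:R) d0.
  rewrite rmorph0 add0r rmorph_nat natrM {1}es mulrDr [X in _ + X]mulrCA etau.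
  by rewrite !rmorphD !rmorphM /= !rmorph_nat /= !ratr_int; ring.
have a0 : 0 < a.
  have : 0 < a%:~R * k%:R :> rat by rewrite -ak ltr0n muln_gt0 n0.
  by rewrite pmulr_lgt0 ?ltr0n // ltr0z.
have [A eA] : exists A : nat, a = A%:Z by exists `|a|%N; rewrite gez0_abs // ltW.
rewrite {}eA in es ak a0.
have A0 : (0 < A)%N by [].
have AC : A%:R != 0 :> algC by rewrite pnatr_eq0 -lt0n.
have AQ : A%:R != 0 :> rat by rewrite pnatr_eq0 -lt0n.
pose t := (x %/ A%:Z)%Z.
have [m em] : exists m : nat, (x %% A%:Z)%Z = m%:Z.
  by exists `|(x %% A%:Z)%Z|%N; rewrite gez0_abs // modz_ge0 // -lt0n.
have mA : (m < A)%N by rewrite -ltz_nat -em ltz_pmod.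
have ex : x = t * A%:Z + m%:Z by rewrite -em; exact: divz_eq.
have etau' : tau + t%:~R = ('s_d - m%:R) / A%:R.
  apply: (mulIf AC); rewrite divfK // {1}es ex intrD intrM.
  by rewrite -[(Posz A)%:~R]/(A%:R) -[(Posz m)%:~R]/(m%:R); ring.
have Jt' : J (('s_d - m%:R) / A%:R).
  by rewrite -etau'; apply: JD => //; apply: JO; exact: Oint_int.
have JE : J = lattice d A m.
  apply/seteqP; split=> z.
    move=> /Jgen[x' [q ->]]; exists (x' - q * t), q; rewrite -etau' rmorphB rmorphM /=; ring.
  move=> [x' [q ->]]; apply: JD; first by apply: JO; exact: Oint_int.
  by apply: JM => //; exact: Oint_int.
have Tq (j : int) : ('s_d - m%:R) / A%:R + j%:~R =
    ratr (j%:~R - m%:R / A%:R) + ratr (A%:R^-1) * 's_d.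
  rewrite rmorphB fmorph_div fmorphV !rmorph_nat /= ratr_int; ring.
have bound (j : int) : (A%:R : rat) ^+ 2 <= (j%:~R * A%:R - m%:R) ^+ 2 + d%:R.
  have h : 1 <= (j%:~R - m%:R / A%:R) ^+ 2 + d%:R * (A%:R^-1) ^+ 2 :> rat.
    apply: minq; last by rewrite invr_eq0 AQ orbT.
    by rewrite -Tq; apply: JD => //; apply: JO; exact: Oint_int.
  have A2 : 0 < (A%:R : rat) ^+ 2 by rewrite exprn_gt0 // ltr0n.
  move: h; rewrite -(ler_pM2r A2) mul1r => h; apply: le_trans h _.
  by rewrite le_eqVlt; apply/orP; left; apply/eqP; field.
exists A, m; split=> //.
(* Take [j] among 0 and 1 with [|j * A - m| <= A / 2]; then [bound] gives
   [A ^ 2 <= A ^ 2 / 4 + d]. *)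
- have [h|h] := leqP (2 * m) A.
    have := bound 0; rewrite mul0r sub0r sqrrN -!natrX -natrD ler_nat.
    have : (2 * m * (2 * m) <= A * A)%N by rewrite leq_mul.
    by rewrite -!mulnn; lia.
  have := bound 1; rewrite mul1r -natrB; last exact: ltnW.
  rewrite -!natrX -natrD ler_nat.
  have : (2 * (A - m) * (2 * (A - m)) <= A * A)%N by rewrite leq_mul //; lia.
  by rewrite -!mulnn; lia.
(* Stability under ['s_d] gives the divisibility: comparing coordinates in the basis exhibits
   [m ^ 2 + d] as a multiple of [A]. *)
- have : J ('s_d * (('s_d - m%:R) / A%:R)) by apply: JM => //; exact: Oint_sqrtCN.
  rewrite JE => -[x' [y e]].
  have [|e1 e2] := @quad_inj d (- d%:R) (- m%:R) (x'%:~R * A%:R - y%:~R * m%:R) y%:~R d0.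
    rewrite !rmorphN rmorphB !rmorphM /= !rmorph_nat /= !ratr_int.
    have := congr1 (fun z => z * A%:R) e; rewrite -mulrA divfK // mulrDl -[in X in _ = _ + X]mulrA divfK //.
    rewrite mulrBr -expr2 sqrtCN_sqr => e'.
    transitivity (- d%:R - 's_d * m%:R); first by ring.
    by rewrite e'; ring.
  have h : (m ^ 2 + d)%N%:Z = (- x') * A%:Z.
    apply: (@intr_inj rat); rewrite intrM rmorphN /= PoszD intrD -[(Posz (m ^ 2))%:~R]/((m ^ 2)%:R).
    rewrite natrX -[(Posz d)%:~R]/(d%:R) -[(Posz A)%:~R]/(A%:R).
    rewrite -e2 in e1; move: e1 => e1; have -> : d%:R = - (x'%:~R * A%:R - - m%:R * m%:R) :> rat by rewrite -e1 opprK.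
    by ring.
  have : (A%:Z %| (m ^ 2 + d)%N%:Z)%Z by apply/dvdzP; exists (- x').
  by rewrite dvdzE !absz_nat.
- apply/ideal_equivP; exists x0^-1; split; [exact: QsqrtV | by rewrite invr_eq0 |].
  rewrite -JE; apply/seteqP; split=> z.
    by move=> Jz; exists (x0 * z) => //; rewrite mulrA mulVf // mul1r.
  by move=> [w Iw <-]; rewrite /J /= mulrA mulfV // mul1r.
Qed.

Lemma sum_nat_seq_const (T : Type) (s : seq T) n : (\sum_(i <- s) n = size s * n)%N.
Proof. by rewrite big_const_seq count_predT iter_addn_0 mulnC. Qed.

(** Cauchy-Schwarz over the fibres of [f]: the fibre sizes [c y] sum to [size X], and their squares
    to the number of colliding pairs. *)
Lemma sqr_size_le_collisions (T U : eqType) (X : seq T) (Y : seq U) (f : T -> U) :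
  uniq Y -> {in X, forall x, f x \in Y} ->
  (size X ^ 2 <= size Y * \sum_(x <- X) \sum_(x' <- X) (f x == f x'))%N.
Proof.
move=> uY fY; pose c y := (\sum_(x <- X) (f x == y))%N.
have one z : z \in Y -> (\sum_(y <- Y) (z == y) = 1)%N.
  by move=> zY; rewrite (bigD1_seq z) //= eqxx big1 // => y /negPf; rewrite eq_sym => ->.
have e1 : size X = (\sum_(y <- Y) c y)%N.
  rewrite /c exchange_big /= -sum1_size big_seq [RHS]big_seq; apply: eq_bigr => x /fY xY.
  by rewrite one.
have e2 : (\sum_(x <- X) \sum_(x' <- X) (f x == f x') = \sum_(y <- Y) c y ^ 2)%N.
  transitivity (\sum_(y <- Y) \sum_(x <- X) \sum_(x' <- X) ((f x == y) * (f x' == y)))%N.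
    rewrite [RHS]exchange_big /= big_seq [RHS]big_seq; apply: eq_bigr => x xX.
    rewrite [RHS]exchange_big /=; apply: eq_bigr => x' _.
    rewrite (bigD1_seq (f x)) ?fY //= eqxx mul1n big1 => [|y /negPf].
      by rewrite addn0 eq_sym.
    by rewrite eq_sym => ->.
  apply: eq_bigr => y _; rewrite -mulnn /c big_distrl /=; apply: eq_bigr => x _.
  by rewrite big_distrr.
rewrite e2 e1 -mulnn big_distrl /= -(@leq_pmul2l 2) //.
apply: (@leq_trans (\sum_(y <- Y) \sum_(y' <- Y) (c y ^ 2 + c y' ^ 2))%N).
  rewrite big_distrr /=; apply: leq_sum => y _; rewrite big_distrr big_distrr /=.
  by apply: leq_sum => y' _; apply: nat_Cauchy.
under eq_bigr do rewrite big_split /= sum_nat_seq_const.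
by rewrite big_split /= -big_distrr /= sum_nat_seq_const; lia.
Qed.

Lemma count_le1 (T : eqType) (P : pred T) (s : seq T) : uniq s ->
  {in s &, forall x y, P x -> P y -> x = y} -> (count P s <= 1)%N.
Proof.
move=> us h; rewrite -size_filter.
case e : [seq x <- s | P x] (filter_uniq P us) => [|x [|y t]] //= /andP[xy _].
have /andP[Px xs] : P x && (x \in s) by rewrite -mem_filter e mem_head.
have /andP[Py ys] : P y && (y \in s) by rewrite -mem_filter e inE mem_head orbT.
by move: xy; rewrite (h x y) // mem_head.
Qed.

Lemma splits_root d p : splits d p -> prime p -> (2 < p)%N -> exists m : int, split_root d p m.
Proof.
move=> /andP[pd /hasP[m _ /dvdnP[k ek]]] pp p2; exists m%:Z; split.
  by exists k%:Z; rewrite mulrC -PoszM -ek PoszD -mulnn PoszM expr2.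
apply: Bezout_coprimez; rewrite abszM !absz_nat coprimeMr.
rewrite !prime_coprime // gtnNdvd //=; apply: contra pd => pm.
have : (p %| m ^ 2 + d)%N by rewrite ek dvdn_mull.
by rewrite dvdn_addr // dvdn_exp.
Qed.

(** Listed with [m] first, so that a bound on divisor counts bounds the length, and with it the
    class number. *)
Definition reduced_pairs (d S : nat) : seq (nat * nat) :=
  [seq (m, a) | m <- iota 0 S, a <- divisors (m ^ 2 + d)].

Lemma size_reduced_pairs d S D : (0 < d)%N ->
  (forall n, (0 < n <= S ^ 2 + d)%N -> (size (divisors n) <= D)%N) ->
  (size (reduced_pairs d S) <= S * D)%N.
Proof.
move=> d0 hD; rewrite size_allpairs_dep sumnE big_map.
apply: (@leq_trans (\sum_(m <- iota 0 S) D)%N).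
  rewrite big_seq [X in (_ <= X)%N]big_seq; apply: leq_sum => m.
  rewrite mem_iota add0n => /andP[_ mS]; apply: hD.
  by rewrite addn_gt0 d0 orbT leq_add2r leq_sqr ltnW.
by rewrite sum_nat_seq_const size_iota.
Qed.

Lemma reduction_pair d S I : (0 < d)%N -> squarefree d -> (4 * d < 3 * S.+1 ^ 2)%N ->
  fractional_ideal d I ->
  exists x, x \in reduced_pairs d S /\ ideal_equiv d I (lattice d x.2 x.1).
Proof.
move=> d0 sq hS fI; have [a [m [ma ha am e]]] := reduction d0 sq fI.
exists (m, a); split=> //; apply/allpairsPdep; exists m, a; split=> //.
  rewrite mem_iota add0n /=.
  have : (a ^ 2 < S.+1 ^ 2)%N by lia.
  by rewrite ltn_sqr; lia.
by rewrite -dvdn_divisors // addn_gt0 d0 orbT.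
Qed.

Definition repr_pair (g d p p' : nat) : bool :=
  (p != p') && (primitively_repr (4 * (p * p') ^ g) d || primitively_repr ((p * p') ^ g) d).

Definition num_repr_pairs (g Z d : nat) : nat :=
  (\sum_(p <- odd_primes Z) \sum_(p' <- odd_primes Z) repr_pair g d p p')%N.

Lemma ideal_mul_prime_inj d I J p m : (0 < d)%N -> (0 < p)%N -> split_root d p m ->
  fractional_ideal d I -> fractional_ideal d J ->
  ideal_equiv d (ideal_mul I (prime_ideal d p m)) (ideal_mul J (prime_ideal d p m)) ->
  ideal_equiv d I J.
Proof.
move=> d0 p0 sr fI fJ e.
have h K : fractional_ideal d K -> ideal_equiv d K
    (ideal_mul (ideal_mul K (prime_ideal d p m)) (prime_ideal d p (- m))).
  move=> fK; rewrite -ideal_mulA prime_ideal_mul // ideal_mulC ideal_mul_scalel ideal_mul_Ointl //.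
  by apply: ideal_equiv_scale; [exact: Qsqrt_nat | rewrite pnatr_eq0 -lt0n].
apply: ideal_equiv_trans (h _ fI) _.
apply: ideal_equiv_trans (ideal_equiv_sym d0 (h _ fJ)).
by apply: ideal_equiv_mul => //; exact: ideal_equiv_refl.
Qed.

(** The [n * M] products of a [g]-torsion class and a split prime are sent to at most [S * D]
    reduced pairs. [sqr_size_le_collisions] gives [(n * M) ^ 2 <= S * D * n * (M + E)] with
    [E = num_repr_pairs g Z d], and one factor [n] cancels. *)
Lemma class_number_part_le (R : realType) (g d Z S D : nat) (M := num_splits Z d) :
  (0 < g)%N -> (0 < d)%N -> squarefree d -> (4 * d < 3 * S.+1 ^ 2)%N ->
  (forall n, (0 < n <= S ^ 2 + d)%N -> (size (divisors n) <= D)%N) ->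
  exists n : nat, [/\ class_number_part R g d = n%:R%:E, (n <= S * D)%N &
    (n * M ^ 2 <= S * D * (M + num_repr_pairs g Z d))%N].
Proof.
move=> g0 d0 sq hS hD.
have sizeQ := size_reduced_pairs d0 hD; set Q := reduced_pairs d S in sizeQ.
set A := [set C | class_group d C /\ class_exp d C g = principal_class d].
(* Representatives are fixed once: an ideal for each class, a reduced pair for each ideal, a root
   for each split prime. Values outside the stated conditions are arbitrary. *)
have /choice[If IfP] : forall C, exists I, A C -> [/\ fractional_ideal d I,
    C = class_of d I & ideal_equiv d (Oint d) (ideal_exp d I g)].
  move=> C.
  have [[[I fI eC] eg]|nA] := pselect (A C); last by exists set0.
  exists I => _; split=> //.
  by have := class_exp_mem g fI; rewrite eC eg => -[].
have /choice[rep repP] : forall I, exists x, fractional_ideal d I ->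
    x \in Q /\ ideal_equiv d I (lattice d x.2 x.1).
  move=> I.
  have [fI|nfI] := pselect (fractional_ideal d I); last by exists (0, 0)%N.
  by have [x hx] := reduction_pair d0 sq hS fI; exists x.
have /choice[rt rtP] : forall p, exists m : int,
    splits d p && prime p && (2 < p)%N -> split_root d p m.
  move=> p.
  have [/andP[/andP[sp pp] p2]|//] := boolP (splits d p && prime p && (2 < p)%N); last by exists 0.
  by have [m hm] := splits_root sp pp p2; exists m.
have rep_eq I J : fractional_ideal d I -> fractional_ideal d J -> rep I = rep J ->
    ideal_equiv d I J.
  move=> fI fJ e; have [_ eI] := repP I fI; have [_ eJ] := repP J fJ; rewrite e in eI.
  exact: ideal_equiv_trans eI (ideal_equiv_sym d0 eJ).
have finA : finite_set A.
  apply: (@sub_finite_set _ _ [set class_of d (lattice d x.2 x.1) | x in [set` Q]]).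
    move=> C AC; have [fI eC _] := IfP C AC; have [xQ e] := repP _ fI.
    by exists (rep (If C)) => //; rewrite [RHS]eC; apply/esym/class_of_eq.
  by apply: finite_image; exact: finite_seq.
pose cs : seq (set (set algC)) := finmap.enum_fset (fset_set A).
have csA C : C \in cs -> A C by move=> h; apply/set_mem; rewrite -(in_fset_set finA).
have ucs : uniq cs by exact: finmap.fset_uniq.
exists (size cs); split.
- by rewrite /class_number_part /counting asboolT.
- apply: leq_trans sizeQ; rewrite -(size_map (fun C => rep (If C))).
  apply: uniq_leq_size; last first.
    by move=> _ /mapP[C /csA/IfP[fI _ _] ->]; have [] := repP _ fI.
  rewrite map_inj_in_uniq // => C C' /csA/IfP[fI eC _] /csA/IfP[fI' eC' _] e.
  by rewrite [LHS]eC [RHS]eC'; apply: class_of_eq => //; exact: rep_eq.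
pose L := [seq p <- odd_primes Z | splits d p].
have LP p : p \in L -> [/\ prime p, (2 < p)%N, (0 < p)%N & split_root d p (rt p)].
  rewrite mem_filter => /andP[sp /odd_primesP[pp p2 _]].
  by split=> //; [exact: prime_gt0 | apply: rtP; rewrite sp pp p2].
have sizeL : size L = M by rewrite size_filter.
pose F (x : set (set algC) * nat) := ideal_mul (If x.1) (prime_ideal d x.2 (rt x.2)).
have fF C p : A C -> p \in L -> fractional_ideal d (F (C, p)).
  move=> /IfP[fI _ _] /LP[_ _ p0 _]; apply: fractional_ideal_mul => //.
  exact: fractional_prime_ideal.
have uQ : uniq (undup Q) by exact: undup_uniq.
have := @sqr_size_le_collisions _ _ [seq (C, p) | C <- cs, p <- L] _ (rep \o F) uQ.
have FQ : {in [seq (C, p) | C <- cs, p <- L], forall x, (rep \o F) x \in undup Q}.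
  move=> _ /allpairsP[[C p] [/= /csA AC pL ->]]; rewrite mem_undup.
  by have [] := repP _ (fF _ _ AC pL).
move=> /(_ FQ).
rewrite size_allpairs sizeL.
have coll : (\sum_(x <- [seq (C, p) | C <- cs, p <- L]) \sum_(x' <- [seq (C, p) | C <- cs, p <- L])
    ((rep \o F) x == (rep \o F) x') <= size cs * (M + num_repr_pairs g Z d))%N.
  rewrite big_allpairs /=.
  rewrite -sum_nat_seq_const big_seq [X in (_ <= X)%N]big_seq; apply: leq_sum => C Ccs.
  apply: (@leq_trans (\sum_(p <- L) \sum_(p' <- L) ((p == p') + repr_pair g d p p'))%N).
    rewrite big_seq [X in (_ <= X)%N]big_seq; apply: leq_sum => p pL.
    rewrite big_allpairs /= exchange_big /=.
    rewrite big_seq [X in (_ <= X)%N]big_seq; apply: leq_sum => p' p'L.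
    rewrite (eq_bigr (fun C' => if rep (F (C, p)) == rep (F (C', p')) then 1 else 0))%N; last first.
      by move=> C' _; case: eqP.
    rewrite -big_mkcond sum1_count.
    have [pp p2 p0 sr] := LP _ pL; have [pp' p2' p'0 sr'] := LP _ p'L.
    have AC := csA _ Ccs; have [fI eC eI] := IfP _ AC.
    have [/eqP e0|] := posnP (count (fun C' => rep (F (C, p)) == rep (F (C', p'))) cs).
      by rewrite (eqP e0).
    rewrite -has_count => /hasP[C1 C1cs /eqP e1].
    (* For fixed [C], [p] and [p'], at most one [C'] collides, because the prime ideal at [p']
       cancels. *)
    apply: (@leq_trans 1).
      apply: count_le1 => // C2 C3 C2cs C3cs /eqP h2 /eqP h3.
      have A2 := csA _ C2cs; have A3 := csA _ C3cs.
      have [f2 e2 _] := IfP _ A2; have [f3 e3 _] := IfP _ A3.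
      rewrite [LHS]e2 [RHS]e3; apply: class_of_eq => //.
      apply: (ideal_mul_prime_inj d0 p'0 sr' f2 f3); apply: rep_eq.
      + exact: (fF _ _ A2 p'L).
      + exact: (fF _ _ A3 p'L).
      + by rewrite -h2 -h3.
    have [//|neq] := eqVneq p p'; rewrite /repr_pair neq /=.
    have A1 := csA _ C1cs; have [f1 _ e1g] := IfP _ A1.
    rewrite (collision_repr d0 g0 sq pp pp' p2 p2' neq eI e1g sr sr') //.
    exact: (rep_eq _ _ (fF _ _ AC pL) (fF _ _ A1 p'L) e1).
  under eq_bigr do rewrite big_split /=.
  rewrite big_split /=; apply: leq_add.
    rewrite -sizeL -sum1_size big_seq [X in (_ <= X)%N]big_seq; apply: leq_sum => p pL.
    rewrite (bigD1_seq p) //= ?eqxx ?big1 ?addn0 // => [p' /negPf|].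
      by rewrite eq_sym => ->.
    by rewrite filter_uniq // filter_uniq // iota_uniq.
  rewrite /num_repr_pairs big_filter big_mkcond; apply: leq_sum => p _.
  case: ifP => // _; rewrite big_filter big_mkcond; apply: leq_sum => p' _.
  by case: ifP.
have sQ : (size (undup Q) <= S * D)%N by apply: leq_trans (size_undup _) sizeQ.
move=> h; have {}h := leq_trans h (leq_mul sQ coll).
have [->|n0] := posnP (size cs); first by rewrite mul0n.
rewrite -(leq_pmul2l n0) mulnA mulnn -expnMn; apply: leq_trans h _.
by rewrite mulnCA.
Qed.

(** * Summation over d *)

Lemma leq_expn2r (m n e : nat) : (m <= n -> m ^ e <= n ^ e)%N.
Proof. by move=> le; case: e => // e; rewrite leq_exp2r. Qed.

Lemma sum_num_repr_pairs_le (g N Z T : nat) (n := size (odd_primes Z)) :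
  (forall B, (0 < B <= 4 * Z ^ (2 * g))%N ->
    (\sum_(N <= d < N + N) primitively_repr B d <= T)%N) ->
  (\sum_(N <= d < N + N) num_repr_pairs g Z d <= n ^ 2 * (2 * T))%N.
Proof.
move=> hT; rewrite /num_repr_pairs exchange_big /=.
rewrite -mulnn -mulnA -sum_nat_seq_const big_seq [X in (_ <= X)%N]big_seq.
apply: leq_sum => p /odd_primesP[pp _ pZ]; rewrite exchange_big /=.
rewrite -sum_nat_seq_const big_seq [X in (_ <= X)%N]big_seq.
apply: leq_sum => p' /odd_primesP[pp' _ p'Z].
have B0 : (0 < (p * p') ^ g)%N by rewrite expn_gt0 muln_gt0 !prime_gt0.
have BZ : ((p * p') ^ g <= Z ^ (2 * g))%N.
  by rewrite expnM; apply: leq_expn2r; rewrite -mulnn leq_mul.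
have h1 := hT (4 * (p * p') ^ g)%N; have h2 := hT ((p * p') ^ g)%N.
apply: (@leq_trans (\sum_(N <= d < N + N) (primitively_repr (4 * (p * p') ^ g) d
   + primitively_repr ((p * p') ^ g) d))%N).
  apply: leq_sum => d _; rewrite /repr_pair; case: (p != p') => //=.
  by case: (primitively_repr _ d); case: (primitively_repr _ d).
rewrite big_split /= mul2n -addnn leq_add //.
  by apply: h1; rewrite muln_gt0 B0 leq_mul2l BZ.
by apply: h2; rewrite B0 (leq_trans BZ) // leq_pmull.
Qed.

(** For [6 * M >= n], dividing the collision bound by [M ^ 2] gives
    [n ^ 2 * h d <= Q * (6 * n + 36 * E)]; otherwise [h d <= Q] is used. In the sum, [6 * n * N] and
    the [36 * n * N] of [few_unsplit] make 42, and [36 * 2 * T] makes 72. *)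
Lemma dyadic_sum_nat_le (h : nat -> nat) (g N Z Q T : nat) (n := size (odd_primes Z)) :
  (0 < n)%N ->
  (forall d, (N <= d < N + N)%N -> (h d <= Q)%N /\
    (h d * num_splits Z d ^ 2 <= Q * (num_splits Z d + num_repr_pairs g Z d))%N) ->
  (forall B, (0 < B <= 4 * Z ^ (2 * g))%N ->
    (\sum_(N <= d < N + N) primitively_repr B d <= T)%N) ->
  (n * \sum_(N <= d < N + N) h d <= Q * (42 * N + n * (72 * T + 36 * Z ^ 2)))%N.
Proof.
move=> n0 hh hT; rewrite -(leq_pmul2l n0) mulnA mulnn.
have pointwise d : (N <= d < N + N)%N -> (n ^ 2 * h d <=
    Q * (6 * n + 36 * num_repr_pairs g Z d + n ^ 2 * (6 * num_splits Z d < n)))%N.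
  move=> /hh[h1 h2]; set M := num_splits Z d in h2 *; set E := num_repr_pairs g Z d in h2 *.
  have [lt|le] := ltnP (6 * M) n.
    by rewrite muln1 mulnC; apply: leq_mul => //; lia.
  have M0 : (0 < M)%N by lia.
  rewrite muln0 addn0 -(@leq_pmul2r (M ^ 2)) ?expn_gt0 ?M0 //.
  apply: (@leq_trans (n ^ 2 * (Q * (M + E))))%N.
    by rewrite -mulnA leq_mul2l h2 orbT.
  rewrite mulnCA -mulnA leq_mul2l; apply/orP; right.
  have a1 : (n * n <= 6 * M * n)%N by rewrite leq_mul2r le orbT.
  have a2 : (n * n <= (6 * M) * (6 * M))%N by rewrite leq_mul.
  have a3 : (n * n * M <= 6 * M * n * M)%N by rewrite leq_mul2r a1 orbT.
  have a4 : (n * n * E <= (6 * M) * (6 * M) * E)%N by rewrite leq_mul2r a2 orbT.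
  by rewrite -!mulnn; lia.
apply: (@leq_trans (\sum_(N <= d < N + N)
    Q * (6 * n + 36 * num_repr_pairs g Z d + n ^ 2 * (6 * num_splits Z d < n)))%N).
  rewrite big_distrr /= big_nat [X in (_ <= X)%N]big_nat; exact: leq_sum.
rewrite -big_distrr mulnCA leq_mul2l; apply/orP; right.
have -> : (\sum_(N <= d < N + N)
      (6 * n + 36 * num_repr_pairs g Z d + n ^ 2 * (6 * num_splits Z d < n)) =
    N * (6 * n) + 36 * (\sum_(N <= d < N + N) num_repr_pairs g Z d) +
    n ^ 2 * (\sum_(N <= d < N + N) (6 * num_splits Z d < n)))%N.
  rewrite 2!big_split; congr (_ + _ + _)%N; last by rewrite big_distrr.
    by rewrite sum_nat_const_nat addKn.
  by rewrite big_distrr.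
have := sum_num_repr_pairs_le hT; have := few_unsplit Z N; rewrite -/n => b1 b2.
apply: leq_trans (leq_add (leq_add (leqnn _) (leq_mul (leqnn 36) b2)) b1) _.
by rewrite -!mulnn; lia.
Qed.

Lemma divisor_bound (R : realType) (eta : R) : 0 < eta ->
  exists2 K : R, 0 < K & forall n, (0 < n)%N -> (size (divisors n))%:R <= K * n%:R `^ eta.
Proof.
(* Chosen so that [1 / k <= eta]; the [k]-th root of [size_divisors_expn_le] then has the right
   exponent. *)
move=> eta0; pose k := (Num.truncn eta^-1).+1.
have k0 : 0 < k%:R :> R by rewrite ltr0n.
have keta : k%:R^-1 <= eta.
  by rewrite -[leRHS]invrK lef_pV2 ?posrE ?invr_gt0 // ltW // truncnS_gt.
exists (((k ^ k) ^ (2 ^ k))%:R `^ k%:R^-1); first by rewrite powR_gt0 // ltr0n !expn_gt0.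
move=> n n0; have := size_divisors_expn_le (isT : 0 < k)%N n0.
set t := size _; set C := ((k ^ k) ^ (2 ^ k))%N => le.
have -> : t%:R = (t ^ k)%:R `^ k%:R^-1 :> R.
  by rewrite natrX -powR_mulrn // -powRrM mulfV ?gt_eqF // powRr1.
apply: (@le_trans _ _ ((C * n)%:R `^ k%:R^-1)).
  by apply: ge0_ler_powR; rewrite ?nnegrE ?invr_ge0 ?ler_nat // ltW.
rewrite natrM powRM // ler_wpM2l ?powR_ge0 // ler_powR // ler1n //.
Qed.

(** With [m = Z./2], [chebyshev_lower] gives [m * ln 2 <= 2 * n * ln Z], where [n + 1 <= 2 * n]
    absorbs the prime 2. Then [Z <= 3 * m] and [eta * ln Z <= Z ^ eta] produce the constant. *)
Lemma odd_primes_ge (R : realType) (eta : R) : 0 < eta ->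
  exists2 K : R, 0 < K & forall Z, (3 <= Z)%N ->
    (0 < size (odd_primes Z))%N /\ Z%:R <= K * Z%:R `^ eta * (size (odd_primes Z))%:R.
Proof.
move=> eta0; have l2 : 0 < ln (2 : R) by rewrite ln_gt0 // ltr1n.
exists (6 / (eta * ln 2)); first by rewrite divr_gt0 // mulr_gt0.
move=> Z Z3; set n := size _.
have n0 : (0 < n)%N.
  by rewrite /n -has_predT; apply/hasP; exists 3%N; rewrite // mem_filter mem_iota.
split=> //; pose m := Z./2; have eZ := odd_double_half Z; rewrite -/m in eZ.
have m0 : (0 < m)%N by case: (odd Z) eZ; lia.
have mZ : (m.*2 <= Z)%N by rewrite -eZ leq_addl.
have Zm : (Z <= 3 * m)%N by case: (odd Z) eZ; lia.
have cheb : (2 ^ m <= Z ^ (2 * n))%N.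
  apply: leq_trans (chebyshev_lower m0) _.
  apply: (@leq_trans (Z ^ size [seq p <- iota 0 m.*2.+1 | prime p])).
    exact: leq_expn2r.
  rewrite leq_pexp2l; [|lia|].
    by [].
  apply: (@leq_trans n.+1); last by lia.
  rewrite -[n.+1]/(size (2 :: odd_primes Z)); apply: uniq_leq_size.
    by rewrite filter_uniq // iota_uniq.
  move=> p; rewrite mem_filter mem_iota add0n => /andP[pp /andP[_ pm]].
  rewrite inE mem_filter pp mem_iota add0n /=.
  by have := prime_gt1 pp; case: eqP => //= /eqP ? ?; lia.
have Z0 : 0 < Z%:R :> R by rewrite ltr0n; lia.
have lnb : m%:R * ln (2 : R) <= (2 * n)%:R * ln Z%:R.
  rewrite !mulr_natl -!lnXn ?ltr0n //; last by lia.
  by rewrite ler_ln ?posrE ?exprn_gt0 // -!natrX ler_nat.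
have lnZ : eta * ln Z%:R <= Z%:R `^ eta.
  rewrite -ln_powR; have P : 0 < Z%:R `^ eta :> R by exact: powR_gt0.
  move: (Z%:R `^ eta) P => y y0; have : -1 < y - 1 by lra.
  by move/le_ln1Dx; rewrite addrC subrK; lra.
have h1 : Z%:R <= 3 * m%:R :> R by rewrite -natrM ler_nat.
rewrite -mulrA mulrAC ler_pdivlMr; last exact: mulr_gt0.
apply: (@le_trans _ _ (3 * m%:R * (eta * ln 2))).
  by rewrite ler_pM2r // mulr_gt0.
apply: (@le_trans _ _ (3 * eta * ((2 * n)%:R * ln Z%:R))).
  have -> : 3 * m%:R * (eta * ln 2) = 3 * eta * (m%:R * ln 2) :> R by ring.
  by rewrite ler_pM2l // mulr_gt0.
have -> : 3 * eta * ((2 * n)%:R * ln Z%:R) = 6 * n%:R * (eta * ln Z%:R) :> R.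
  by rewrite natrM; ring.
rewrite [leRHS](_ : _ = 6 * n%:R * Z%:R `^ eta); last by ring.
by rewrite ler_wpM2l // mulr_ge0.
Qed.

Lemma primitively_repr_count_real (R : realType) (N B D : nat) : (0 < N)%N -> (0 < B)%N ->
  (forall n, (0 < n <= B)%N -> (size (divisors n) <= D)%N) ->
  (\sum_(N <= d < N + N) primitively_repr B d)%:R
    <= D%:R * (8 * Num.sqrt N%:R + Num.sqrt B%:R / Num.sqrt N%:R) :> R.
Proof.
move=> N0 B0 hD; set r := Num.sqrt N%:R; set q := Num.sqrt B%:R.
have r0 : 0 < r :> R by rewrite sqrtr_gt0 ltr0n.
have q0 : 0 < q :> R by rewrite sqrtr_gt0 ltr0n.
have r2 : r ^+ 2 = N%:R :> R by rewrite sqr_sqrtr.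
have q2 : q ^+ 2 = B%:R :> R by rewrite sqr_sqrtr.
have q1 : 1 <= q by rewrite -[leLHS]sqrtr1; apply: ler_wsqrtr; rewrite ler1n.
(* Integer parts of [sqrt B] and [sqrt (B / N)]; rounding costs [q <= 2 * b], which turns 4 into
   8. *)
pose b := Num.truncn q; pose W := Num.truncn (q / r).
have /andP[bq qb] := truncn_itv (ltW q0); rewrite -/b in bq qb.
have /andP[Wq qW] := truncn_itv (ltW (divr_gt0 q0 r0)); rewrite -/W in Wq qW.
have b1 : (0 < b)%N by rewrite truncn_gt0.
have bR : 1 <= b%:R :> R by rewrite ler1n.
have hb : (b ^ 2 <= B)%N.
  by rewrite -(ler_nat R) natrX -q2 ler_pXn2r ?nnegrE ?ler0n // ltW.
have hW : (B < N * W.+1 ^ 2)%N.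
  rewrite -(ltr_nat R) natrM natrX -q2 -r2 -exprMn ltr_pXn2r ?nnegrE ?ltW //; last first.
    by apply: mulr_gt0 => //; rewrite ltr0n.
  by rewrite mulrC -ltr_pdivrMr.
have := primitively_repr_count b1 hb hW hD; rewrite -(ler_nat R) => h; apply: le_trans h _.
rewrite !natrM mulrCA ler_wpM2l //.
have h4 : (4 * N %/ b)%:R <= 8 * N%:R / q :> R.
  have : (4 * N %/ b)%:R * b%:R <= 4 * N%:R :> R by rewrite -!natrM ler_nat leq_trunc_div.
  rewrite ler_pdivlMr //; set c := (_ %/ _)%:R => hc.
  have c0 : 0 <= c by rewrite ler0n.
  rewrite -natr1 in qb; nra.
apply: (@le_trans _ _ (q / r * (8 * N%:R / q + 1))).
  by apply: ler_pM => //; rewrite -natr1 lerD2r.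
rewrite -r2 le_eqVlt; apply/orP; left; apply/eqP; field.
by rewrite !gt_eqF.
Qed.

(** Stated for any [h] obeying the two bounds of [class_number_part_le], so that only the choice of
    parameters remains. *)
Lemma dyadic_sum_le (R : realType) (h : nat -> nat) (g : nat) (eps : R) :
  (5 <= g)%N -> 0 < eps ->
  (forall d Z S D, (0 < d)%N -> (4 * d < 3 * S.+1 ^ 2)%N ->
    (forall n, (0 < n <= S ^ 2 + d)%N -> (size (divisors n) <= D)%N) ->
    (h d <= S * D)%N /\
    (h d * num_splits Z d ^ 2 <= S * D * (num_splits Z d + num_repr_pairs g Z d))%N) ->
  exists2 C : R, 0 < C & forall N, (0 < N)%N ->
    (\sum_(N <= d < N + N) h d)%:R <= C * N%:R `^ (3 / 2 - 3 / (2 * g%:R + 2) + eps).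
Proof.
move=> g5 eps0 hh; set beta := 3 / (2 * g%:R + 2).
(* The divisor bound enters twice as [y ^ 3], once through [S * D] and once through [T]; together
   they make [y ^ 6], which is [N ^ eps]. *)
pose eta := eps / 6; have eta0 : 0 < eta by rewrite divr_gt0.
have [K K0 divK] := divisor_bound eta0.
have [K2 K20 chebK] := odd_primes_ge eta0.
pose K' := K * 6 `^ eta; have K'0 : 0 < K' by rewrite mulr_gt0 ?powR_gt0.
(* [2 * K'] comes from [S * D]; in the bracket, 84 is [42 * 2] through [xn], 720 is [72 * 10]
   through [T], and 36 belongs to [Z ^ 2]. *)
exists (2 * K' * (84 * K2 + 720 * K' + 36)).
  by apply: mulr_gt0; lra.
move=> N N0; set x : R := N%:R; have x1 : 1 <= x by rewrite ler1n.
have x0 : 0 < x by rewrite ltr0n.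
pose r := Num.sqrt x; pose a := x `^ beta; pose y := x `^ eta.
have r0 : 0 < r by rewrite sqrtr_gt0.
have r2 : r ^+ 2 = x by rewrite sqr_sqrtr // ltW.
have rE : r = x `^ 2^-1 by rewrite powR12_sqrt // ltW.
have gR : 5 <= g%:R :> R by rewrite ler_nat.
have g1 : 0 < 2 * g%:R + 2 :> R by lra.
have beta0 : 0 < beta by rewrite divr_gt0.
have beta4 : beta <= 4^-1 by rewrite ler_pdivrMr //; lra.
have xp s t : s <= t -> x `^ s <= x `^ t by move=> st; apply: ler_powR.
have xp1 s : 0 <= s -> 1 <= x `^ s by move=> s0; rewrite -(powRr0 x); apply: xp.
have xD s t : x `^ (s + t) = x `^ s * x `^ t by apply: powRD; apply/implyP => _; rewrite gt_eqF.
have a1 : 1 <= a by apply: xp1; exact: ltW.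
have a0 : 0 < a by apply: lt_le_trans a1.
have y1 : 1 <= y by apply: xp1; exact: ltW.
have y0 : 0 < y by apply: lt_le_trans y1.
have aX n : a ^+ n = x `^ (beta * n%:R) by rewrite -(powR_mulrn n (ltW a0)) -powRrM.
have yX n : y ^+ n = x `^ (eta * n%:R) by rewrite -(powR_mulrn n (ltW y0)) -powRrM.
have xx : x = x `^ 1 by rewrite powRr1 // ltW.
have a3 : a ^+ 3 <= x by rewrite aX [leRHS]xx; apply: xp; lra.
have ar : a <= r by rewrite rE; apply: xp; lra.
have ag : a ^+ g * a = x * r.
  rewrite -exprSr aX rE [in RHS]xx -powRrM -xD; congr (_ `^ _).
  by rewrite /beta -natr1; field; rewrite gt_eqF.
have xE : x `^ (3 / 2 - beta + eps) = x * r / a * y ^+ 6.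
  have -> : 3 / 2 - beta + eps = 1 + 2^-1 - beta + eta *+ 6.
    by rewrite /eta -mulr_natr; field.
  by rewrite 3!xD -xx -rE powRN -/a yX mulr_natr.
rewrite xE; pose Z := Num.truncn a.
have /andP[za az] := truncn_itv (ltW a0); rewrite -/Z in za az.
set z : R := Z%:R in za; have z1 : 1 <= z by rewrite ler1n truncn_gt0.
have z0 : 0 < z by apply: lt_le_trans z1.
have az2 : a <= 2 * z by rewrite -natr1 -/z in az; lra.
have zg : z ^+ g <= x * r / a.
  apply: (@le_trans _ _ (a ^+ g)); first by rewrite lerXn2r ?nnegrE // ltW.
  by rewrite ler_pdivlMr // ag.
pose S := Num.truncn (2 * r).
have r20 : 0 <= 2 * r by rewrite mulr_ge0 // ltW.
have /andP[Sr rS] := truncn_itv r20; rewrite -/S in Sr rS.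
(* One bound serves both uses: [S ^ 2 + d <= 6 * x] for the class numbers and [B <= 4 * x ^ 3] for
   the represented values. *)
pose D := Num.truncn (K * (6 * x ^+ 3) `^ eta).
have D0 : 0 <= K * (6 * x ^+ 3) `^ eta by rewrite mulr_ge0 ?powR_ge0 // ltW.
have /andP[DK _] := truncn_itv D0; rewrite -/D in DK.
have DK' : D%:R <= K' * y ^+ 3.
  apply: le_trans DK _; rewrite powRM; [|by []|by apply: exprn_ge0; exact: ltW].
  by rewrite mulrA -(powR_mulrn 3 (ltW x0)) -powRrM yX [3%:R * eta]mulrC.
have hD n : (0 < n)%N -> n%:R <= 6 * x ^+ 3 -> (size (divisors n) <= D)%N.
  move=> n0 nx; rewrite truncn_ge_nat //; apply: le_trans (divK n n0) _.
  apply: ler_wpM2l; first exact: ltW.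
  apply: ge0_ler_powR; rewrite ?nnegrE //; first exact: ltW.
  by apply: mulr_ge0 => //; apply: exprn_ge0; exact: ltW.
have x3 : x <= x ^+ 3 by rewrite -{1}(expr1 x) ler_weXn2l.
have hS d : (N <= d < N + N)%N -> [/\ (0 < d)%N, (4 * d < 3 * S.+1 ^ 2)%N &
    forall n, (0 < n <= S ^ 2 + d)%N -> (size (divisors n) <= D)%N].
  move=> /andP[Nd dN]; have dN2 : (d <= 2 * N)%N by clear -dN; lia.
  have dx : d%:R <= 2 * x :> R by rewrite /x -natrM ler_nat.
  split; first by apply: leq_trans Nd.
    rewrite -(ltr_nat R) natrM [ltRHS]natrM natrX.
    apply: (@lt_le_trans _ _ (3 * (2 * r) ^+ 2)); first by rewrite exprMn r2; nra.
    by rewrite ler_wpM2l // lerXn2r ?nnegrE // ltW.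
  move=> n /andP[n0 nS]; apply: hD => //; apply: (@le_trans _ _ (S ^ 2 + d)%:R).
    by rewrite ler_nat.
  rewrite natrD natrX; have : (S%:R : R) ^+ 2 <= (2 * r) ^+ 2 by rewrite lerXn2r ?nnegrE.
  by rewrite exprMn r2; nra.
have D0' : 0 <= D%:R :> R by [].
have y3 : 1 <= y ^+ 3 by rewrite exprn_ege1.
have xa : x / a > 0 by rewrite divr_gt0.
(* For [Z < 3] there is no odd prime to use, but [a < 3] is bounded and the trivial [h d <= S * D]
   suffices. *)
have [Z3|Z3] := ltnP Z 3.
  have a3' : a < 3.
    by apply: lt_le_trans az _; rewrite ler_nat.
  have sN : (\sum_(N <= d < N + N) h d <= N * (S * D))%N.
    apply: (@leq_trans (\sum_(N <= d < N + N) S * D)%N); last by rewrite sum_nat_const_nat addKn.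
    rewrite big_nat [X in (_ <= X)%N]big_nat; apply: leq_sum => d /hS[d0 dS dD].
    by have [] := hh d Z S D d0 dS dD.
  apply: (@le_trans _ _ (x * (2 * r * (K' * y ^+ 3)))).
    apply: (@le_trans _ _ (N * (S * D))%:R); first by rewrite ler_nat.
    by rewrite !natrM; apply: ler_wpM2l; [exact: ltW | exact: ler_pM].
  have -> : x * (2 * r * (K' * y ^+ 3)) = 2 * K' * a * (x * r / a * y ^+ 3) by field; rewrite gt_eqF.
  have xra : 0 < x * r / a by rewrite divr_gt0 // mulr_gt0.
  have y36 : y ^+ 3 <= y ^+ 6 by rewrite ler_weXn2l.
  have y30 : 0 < y ^+ 3 by exact: exprn_gt0.
  apply: ler_pM.
  - by apply: mulr_ge0; [apply: mulr_ge0 => //|]; exact: ltW.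
  - by apply: mulr_ge0; exact: ltW.
  - by apply: ler_wpM2l; [apply: mulr_ge0 => //; exact: ltW | lra].
  - by apply: ler_wpM2l => //; exact: ltW.
have [n0 nZ] := chebK Z Z3; set n := size (odd_primes Z) in n0 nZ.
(* The count is at most [D * (8 * r + 2 * (x / a))], and [r <= x / a], whence 10. *)
pose T := Num.truncn (10 * D%:R * (x / a)).
have T0 : 0 <= 10 * D%:R * (x / a) by apply: mulr_ge0; [exact: mulr_ge0 | exact: ltW].
have /andP[TD _] := truncn_itv T0; rewrite -/T in TD.
have hT B : (0 < B <= 4 * Z ^ (2 * g))%N -> (\sum_(N <= d < N + N) primitively_repr B d <= T)%N.
  move=> /andP[B0 BZ]; rewrite truncn_ge_nat //.
  have zgx : (z ^+ g) ^+ 2 <= x ^+ 3.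
    have -> : x ^+ 3 = (x * r) ^+ 2 by rewrite exprMn r2; ring.
    have xr0 : 0 < x * r by exact: mulr_gt0.
    apply: lerXn2r; rewrite ?nnegrE; [by apply: exprn_ge0; exact: ltW | exact: ltW |].
    by apply: le_trans zg _; rewrite ler_pdivrMr // ler_peMr // ltW.
  have Bz : B%:R <= (2 * z ^+ g) ^+ 2 :> R.
    apply: (@le_trans _ _ (4 * Z ^ (2 * g))%:R); first by rewrite ler_nat.
    by rewrite le_eqVlt; apply/orP; left; apply/eqP; rewrite natrM natrX -/z mulnC exprM; ring.
  apply: le_trans (primitively_repr_count_real R N0 B0 (D := D) _) _.
    move=> m /andP[m0 mB]; apply: hD => //; apply: (@le_trans _ _ B%:R); first by rewrite ler_nat.
    by apply: le_trans Bz _; rewrite exprMn; nra.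
  rewrite -/x -/r [10 * _]mulrC -mulrA ler_wpM2l //.
  have h1 : r <= x / a by rewrite ler_pdivlMr // -r2 expr2; apply: ler_wpM2l => //; exact: ltW.
  have h2 : Num.sqrt B%:R / r <= 2 * (x / a).
    rewrite ler_pdivrMr //; apply: (@le_trans _ _ (2 * z ^+ g)).
      have zg0 : 0 <= 2 * z ^+ g by apply: mulr_ge0 => //; apply: exprn_ge0; exact: ltW.
      by rewrite -(@ler_pXn2r _ 2) ?nnegrE ?sqrtr_ge0 // sqr_sqrtr.
    apply: (@le_trans _ _ (2 * (x * r / a))); first by rewrite ler_wpM2l.
    by rewrite le_eqVlt; apply/orP; left; apply/eqP; field; rewrite gt_eqF.
  by lra.
have main := dyadic_sum_nat_le (Q := S * D) n0 _ hT.
have {main} : (n * \sum_(N <= d < N + N) h d <=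
    S * D * (42 * N + n * (72 * T + 36 * Z ^ 2)))%N.
  by apply: main => d /hS[d0 dS dD]; exact: hh.
rewrite -(ler_nat R) natrM; set Sg := (\sum_(_ <= _ < _) _)%:R => main.
have nR : 0 < n%:R :> R by rewrite ltr0n.
have xn : x <= n%:R * (2 * K2 * y * (x / a)).
  have zy : z `^ eta <= y.
    apply: ge0_ler_powR; rewrite ?nnegrE; try exact: ltW.
    by apply: le_trans za _; apply: le_trans a3; rewrite -{1}(expr1 a) ler_weXn2l.
  have e1 : a <= 2 * K2 * y * n%:R.
    apply: le_trans az2 _; rewrite -!mulrA ler_wpM2l //; apply: le_trans nZ _.
    by rewrite -!mulrA; apply: ler_wpM2l; [exact: ltW | apply: ler_wpM2r => //; exact: ltW].
  have -> : n%:R * (2 * K2 * y * (x / a)) = (2 * K2 * y * n%:R) * x / a by ring.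
  by rewrite ler_pdivlMr // mulrC; apply: ler_wpM2r => //; exact: ltW.
have SD : (S * D)%:R <= 2 * r * (K' * y ^+ 3) by rewrite natrM ler_pM.
have z2 : z ^+ 2 <= x / a.
  rewrite ler_pdivlMr //; apply: le_trans a3; rewrite [leRHS]exprSr.
  apply: ler_wpM2r; first exact: ltW.
  by apply: lerXn2r; rewrite ?nnegrE //; exact: ltW.
have y13 : y <= y ^+ 3 by rewrite -{1}(expr1 y) ler_weXn2l.
have TD' : T%:R <= 10 * (K' * y ^+ 3) * (x / a).
  by apply: le_trans TD _; apply: ler_wpM2r; [exact: ltW | exact: ler_wpM2l].
have bracket : 42 * x + n%:R * (72 * T%:R + 36 * z ^+ 2) <=
    n%:R * (y ^+ 3 * (x / a) * (84 * K2 + 720 * K' + 36)).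
  apply: (@le_trans _ _ (n%:R * (84 * K2 * y * (x / a) + 720 * (K' * y ^+ 3) * (x / a) + 36 * (x / a)))).
    have : n%:R * (72 * T%:R + 36 * z ^+ 2) <= n%:R * (720 * (K' * y ^+ 3) * (x / a) + 36 * (x / a)).
      by rewrite ler_wpM2l //; lra.
    move=> h1; have h2 : 42 * x <= n%:R * (84 * K2 * y * (x / a)).
      have -> : n%:R * (84 * K2 * y * (x / a)) = 42 * (n%:R * (2 * K2 * y * (x / a))) by ring.
      by rewrite ler_pM2l.
    by apply: le_trans (lerD h2 h1) _; rewrite -mulrDr addrA.
  rewrite ler_wpM2l //.
  have u1 : K2 * (x / a) * y <= K2 * (x / a) * y ^+ 3 by apply: ler_wpM2l => //; apply: mulr_ge0; exact: ltW.
  have u2 : x / a <= x / a * y ^+ 3 by rewrite ler_peMr // ltW.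
  move: (x / a) (y ^+ 3) u1 u2 => A Y; lra.
rewrite -(ler_pM2l nR); apply: le_trans main _.
have -> : (S * D * (42 * N + n * (72 * T + 36 * Z ^ 2)))%:R =
    (S * D)%:R * (42 * x + n%:R * (72 * T%:R + 36 * z ^+ 2)) :> R.
  by rewrite natrM; congr (_ * _); rewrite natrD natrM (natrM R n) natrD !natrM expr2.
apply: le_trans (ler_pM _ _ SD bracket) _; rewrite ?ler0n //.
  have z20 : 0 <= z ^+ 2 by exact: sqr_ge0.
  by apply: addr_ge0; [lra | apply: mulr_ge0 => //; have : 0 <= T%:R :> R by []; lra].
by rewrite le_eqVlt; apply/orP; left; apply/eqP; ring.
Qed.

(** Doubling the range keeps the same constant [C], because [1 + 1 <= 2 ^ e]. *)
Lemma sum_of_dyadic_sums_le (R : realType) (h : nat -> nat) (C e : R) : 0 < C -> 1 <= e ->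
  (forall N, (0 < N)%N -> (\sum_(N <= d < N + N) h d)%:R <= C * N%:R `^ e) ->
  forall J, (\sum_(1 <= d < 2 ^ J) h d)%:R <= C * (2 ^ J)%:R `^ e.
Proof.
move=> C0 e1 hC; elim=> [|J IH].
  by rewrite expn0 big_geq // mulr_ge0 ?powR_ge0 // ltW.
have J0 : (0 < 2 ^ J)%N by rewrite expn_gt0.
rewrite expnS mul2n -addnn (@big_cat_nat _ _ _ (2 ^ J)) ?leq_addr //= natrD.
apply: le_trans (lerD IH (hC _ J0)) _.
rewrite -mulrDr ler_pM2l // addnn -mul2n natrM powRM //.
rewrite -[X in X + X]mul1r -mulrDl ler_wpM2r ?powR_ge0 //.
by apply: (@le1r_powR R 2 e) => //; rewrite ler1n.
Qed.

(** Only finiteness is wanted, so [S] and [D] are any values meeting the hypotheses of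
    [class_number_part_le]. *)
Lemma class_number_part_nat (R : realType) (g d : nat) : (0 < g)%N -> (0 < d)%N ->
  squarefree d -> exists n : nat, class_number_part R g d = n%:R%:E.
Proof.
move=> g0 d0 sq; pose S := (2 * d)%N.
pose D := (\max_(n < (S ^ 2 + d).+1) size (divisors n))%N.
have hS : (4 * d < 3 * S.+1 ^ 2)%N by rewrite /S -mulnn; nia.
have hD n : (0 < n <= S ^ 2 + d)%N -> (size (divisors n) <= D)%N.
  move=> /andP[_ nS]; have nS' : (n < (S ^ 2 + d).+1)%N by [].
  exact: (leq_bigmax (Ordinal nS') (F := fun i : 'I_(S ^ 2 + d).+1 => size (divisors i))).
by have [n [e _ _]] := class_number_part_le R 0 g0 d0 sq hS hD; exists n.
Qed.

Theorem theorem1 (R : realType) (g : nat) (eps : R)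
    (g_prime : prime g) (g_ge5 : (5 <= g)%N) (eps_gt0 : 0 < eps) :
  exists c : R, forall X : R, 2 <= X ->
    (\sum_(1 <= d < (Num.truncn X).+1 | `[< squarefree d >] && (d%:R < X)%R)
        class_number_part R g d
     <= (c * X `^ (3 / 2 - 3 / (2 * g%:R + 2) + eps))%:E)%E.
Proof.
have g0 := prime_gt0 g_prime.
(* The extended-real counts become a natural-valued function, set to 0 off the positive squarefree
   [d], so that [dyadic_sum_le] applies to full intervals. *)
have /choice[h hP] : forall d, exists n : nat,
    ((0 < d)%N && `[< squarefree d >] -> class_number_part R g d = n%:R%:E) /\
    (~~ ((0 < d)%N && `[< squarefree d >]) -> n = 0%N).
  move=> d; have [/andP[d0 /asboolP sq]|_] := boolP ((0 < d)%N && `[< squarefree d >]).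
    by have [n e] := class_number_part_nat R g0 d0 sq; exists n.
  by exists 0%N.
have hh d Z S D : (0 < d)%N -> (4 * d < 3 * S.+1 ^ 2)%N ->
    (forall n, (0 < n <= S ^ 2 + d)%N -> (size (divisors n) <= D)%N) ->
    (h d <= S * D)%N /\
    (h d * num_splits Z d ^ 2 <= S * D * (num_splits Z d + num_repr_pairs g Z d))%N.
  move=> d0 hS hD; have [hP1 hP2] := hP d.
  have [sqb|nsq] := boolP ((0 < d)%N && `[< squarefree d >]); last by rewrite hP2.
  have /andP[_ /asboolP sq] := sqb.
  have [n [e n1 n2]] := class_number_part_le R Z g0 d0 sq hS hD.
  suff -> : h d = n by [].
  move: e; rewrite hP1 // => -[/eqP]; rewrite eqr_nat => /eqP; exact.
have [C C0 hC] := dyadic_sum_le g_ge5 eps_gt0 hh.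
set e := 3 / 2 - _ + _ in hC *.
have e1 : 1 <= e.
  have gR : 5 <= g%:R :> R by rewrite ler_nat.
  have : 3 / (2 * g%:R + 2) <= 2^-1 :> R by rewrite ler_pdivrMr; lra.
  by rewrite /e; lra.
exists (C * 2 `^ e) => X X2.
have X0 : 0 < X by lra.
have /andP[tX Xt] := truncn_itv (ltW X0); set t := Num.truncn X in tX Xt *.
have t0 : (0 < t)%N by rewrite truncn_gt0; lra.
(* The least power of 2 above [t] is at most [2 * X], which costs the factor [2 ^ e] in the
   constant. *)
pose J := (trunc_log 2 t).+1.
have tJ : (t < 2 ^ J)%N by exact: trunc_log_ltn.
have JX : (2 ^ J)%:R <= 2 * X :> R.
  rewrite expnS natrM ler_pM2l //; apply: le_trans tX; rewrite ler_nat.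
  exact: trunc_logP.
have -> : (\sum_(1 <= d < t.+1 | `[< squarefree d >] && (d%:R < X)%R) class_number_part R g d
    = (\sum_(1 <= d < t.+1 | `[< squarefree d >] && (d%:R < X)%R) h d)%N%:R%:E)%E.
  rewrite natr_sum -sumEFin big_nat_cond [RHS]big_nat_cond; apply: eq_bigr => d.
  by move=> /andP[/andP[d0 _] /andP[sq _]]; have [-> //] := hP d; rewrite d0 sq.
rewrite lee_fin; apply: (@le_trans _ _ (\sum_(1 <= d < 2 ^ J) h d)%:R).
  rewrite ler_nat [X in (_ <= X)%N](@big_cat_nat _ _ _ t.+1) //=.
  apply: leq_trans (leq_addr _ _); rewrite big_mkcond /=; apply: leq_sum => d _.
  by case: ifP.
apply: le_trans (sum_of_dyadic_sums_le C0 e1 hC J) _.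
rewrite -mulrA ler_pM2l // -powRM //; last exact: ltW.
by apply: ge0_ler_powR; rewrite ?nnegrE //; lra.
Qed.
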